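(* Let $S$ be a semigroup with a finite choice of generators $X$. If $S$ is left [respectively, right] amenable then the Markov operator on $\ell_2(S^1)$ of the left [respectively, right] random walk on $S$ (with respect to $X$) is either not defined or has spectral radius at least $1$.
   Context: $S^1$ denotes $S$ with an identity element adjoined if $S$ has no identity, and $S^1=S$ otherwise. A finite choice of generators for a semigroup $S$ is a finite set $X$ of symbols together with a surjective morphism $X^+\to S$, $w\mapsto\overline{w}$, from the free semigroup on $X$. A semigroup $S$ is left amenable if there is a finitely additive probability measure $\mu$, defined on all subsets of $S$, such that $\mu(a^{-1}Y)=\mu(Y)$ for all $Y\subseteq S$ and $a\in S$, where $a^{-1}Y=\{s\in S: as\in Y\}$. Right amenability is the left-right dual notion, with $Ya^{-1}=\{s\in S: sa\in Y\}$ in place of $a^{-1}Y$. The right random walk Markov operator associated with $X$ is given by the $S^1\times S^1$ matrix $M_{s,t}=|\{x\in X: s\overline{x}=t\}|/|X|$, acting by $(vM)(t)=\sum_{s\in S^1}v(s)M_{s,t}$. The left random walk Markov operator is given in the same way by the matrix with $(s,t)$ entry $|\{x\in X:\overline{x}s=t\}|/|X|$. The operator is ''defined on $\ell_2(S^1)$'' if for every $v\in\ell_2(S^1)$ all these sums converge and the result lies in $\ell_2(S^1)$; in this case it is automatically bounded. The spectral radius of $M$ is the supremum of $|\lambda|$ over all complex $\lambda$ such that $M-\lambda I$ is singular (not invertible); equivalently it equals $\limsup_{n\to\infty}\|M^n\|_2^{1/n}$, where $\|\cdot\|_2$ is the operator norm on $\ell_2(S^1)$. *)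

(* Defs.v *)
From HB Require Import structures.
From mathcomp Require Import all_boot all_order all_algebra finmap.
From mathcomp Require Import all_classical all_reals all_analysis.
From mathcomp Require Import summability.
From mathcomp Require Import complex.

Set Implicit Arguments.
Unset Strict Implicit.
Unset Printing Implicit Defensive.
Import Order.TTheory GRing.Theory Num.Theory.
Import ComplexField.Normc numFieldNormedType.Exports.
Local Open Scope classical_set_scope.
Local Open Scope group_scope.

Section FreeSemigroup.
Variable X : choiceType.

Record free_semigroup : Type :=
  FreeWord { word :> seq X; word_neq0 : word != [::] }.

HB.instance Definition _ := [isSub for word].
HB.instance Definition _ := [Choice of free_semigroup by <:].

Lemma free_mul_neq0 (u v : free_semigroup) : word u ++ word v != [::].
Proof. by case: u => -[]. Qed.

Definition free_mul (u v : free_semigroup) : free_semigroup :=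
  FreeWord (free_mul_neq0 u v).

Lemma free_mulA : associative free_mul.
Proof. by move=> u v w; apply: val_inj; rewrite /= catA. Qed.

HB.instance Definition _ := isSemigroup.Build free_semigroup free_mulA.

Definition letter (x : X) : free_semigroup := @FreeWord [:: x] isT.

End FreeSemigroup.

Definition has_identity (S : semigroupType) : Prop :=
  exists e : S, forall s : S, e * s = s /\ s * e = s.

(* The boolean records whether [S] already has an identity; when it is false,
   [None] plays the role of the adjoined one. *)
Definition adjoin (S : semigroupType) (b : bool) : choiceType :=
  if b then (S : choiceType) else (option S : choiceType).

Definition adjoin_mul (S : semigroupType) (b : bool) :
    adjoin S b -> adjoin S b -> adjoin S b :=
  if b return adjoin S b -> adjoin S b -> adjoin S b then
    fun s t : S => s * t
  else fun s t : option S =>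
    match s, t with
    | Some s', Some t' => Some (s' * t')
    | None, _ => t
    | _, None => s
    end.

Definition adjoin_in (S : semigroupType) (b : bool) : S -> adjoin S b :=
  if b return S -> adjoin S b then fun s => s else fun s => Some s.

Lemma adjoin_mulA (S : semigroupType) (b : bool) :
  associative (@adjoin_mul S b).
Proof.
case: b => [x y z|[x|] [y|] [z|]] //=; first exact: mulgA.
by rewrite mulgA.
Qed.

Definition S1 (S : semigroupType) : Type := adjoin S `[< has_identity S >].

HB.instance Definition _ (S : semigroupType) := Choice.on (S1 S).
HB.instance Definition _ (S : semigroupType) :=
  isSemigroup.Build (S1 S) (@adjoin_mulA S `[< has_identity S >]).

Definition inS1 (S : semigroupType) : S -> S1 S :=
  @adjoin_in S `[< has_identity S >].

Local Open Scope ring_scope.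

Definition finitely_additive_probability (R : realType) (T : Type)
    (mu : set T -> R) : Prop :=
  [/\ forall A, 0 <= mu A,
      mu [set: T] = 1 &
      forall A B, A `&` B = set0 -> mu (A `|` B) = mu A + mu B].

Definition left_amenable (R : realType) (S : semigroupType) : Prop :=
  exists mu : set S -> R, finitely_additive_probability mu /\
    forall (Y : set S) (a : S), mu [set s | Y (a * s)%g] = mu Y.

Definition right_amenable (R : realType) (S : semigroupType) : Prop :=
  exists mu : set S -> R, finitely_additive_probability mu /\
    forall (Y : set S) (a : S), mu [set s | Y (s * a)%g] = mu Y.

Section Ell2.
Variables (R : realType) (T : choiceType).
Local Notation C := R[i].
Implicit Types (v : T -> C) (A B : (T -> C) -> T -> C).

Definition ell2 : set (T -> C) :=
  [set v | (\esum_(t in [set: T]) ((normc (v t)) ^+ 2)%:E < +oo)%E].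

Definition ell2_norm v : R :=
  Num.sqrt (fine (\esum_(t in [set: T]) ((normc (v t)) ^+ 2)%:E)).

(* Operators are total maps on functions of which only the restriction to
   [ell2] matters. *)
Definition bounded_operator A : Prop :=
  [/\ forall v, ell2 v -> ell2 (A v),
      forall (a : C) v w, ell2 v -> ell2 w ->
        A (fun t => a * v t + w t) = (fun t => a * A v t + A w t) &
      exists K : R, forall v, ell2 v -> ell2_norm (A v) <= K * ell2_norm v].

Definition invertible A : Prop :=
  exists B, bounded_operator B /\
    forall v, ell2 v -> B (A v) = v /\ A (B v) = v.

Definition spectrum A : set C :=
  [set lambda | ~ invertible (fun v t => A v t - lambda * v t)].

Definition spectral_radius A : \bar R :=
  ereal_sup [set (normc lambda)%:E | lambda in spectrum A].

(* [T] carries no order, so the series defining a coordinate of [vM] is the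
   unordered one: the limit along the net of finite partial sums. *)
Definition mx_summable (M : T -> T -> C) v (t : T) : Prop :=
  cvg (partial_sum (fun s => v s * M s t : C^o) @ totally).

Definition mx_operator (M : T -> T -> C) v : T -> C :=
  fun t => summability.sum (fun s => v s * M s t : C^o).

Definition defined_on_ell2 (M : T -> T -> C) : Prop :=
  forall v, ell2 v ->
    (forall t, mx_summable M v t) /\ ell2 (mx_operator M v).

End Ell2.

Section RandomWalk.
Variables (R : realType) (S : semigroupType) (X : finType).
Variable phi : {multiplicative free_semigroup X -> S}.

Definition gen (x : X) : S1 S := inS1 (phi (letter x)).

Definition right_walk (s t : S1 S) : R[i] :=
  #|[set x : X | (s * gen x)%g == t]%SET|%:R / #|X|%:R.

Definition left_walk (s t : S1 S) : R[i] :=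
  #|[set x : X | (gen x * s)%g == t]%SET|%:R / #|X|%:R.

End RandomWalk.

Arguments right_walk R {S X} phi s t.
Arguments left_walk R {S X} phi s t.

(* Main.v *)
From HB Require Import structures.
Require Import Defs.
From mathcomp Require Import all_boot all_order all_algebra finmap.
From mathcomp Require Import all_classical all_reals all_analysis.
From mathcomp Require Import complex summability ring lra.

Set Implicit Arguments.
Unset Strict Implicit.
Unset Printing Implicit Defensive.
Import Order.TTheory GRing.Theory Num.Theory.
Import ComplexField.Normc numFieldNormedType.Exports.
Local Open Scope classical_set_scope.
Local Open Scope ring_scope.

(** The walk only enters through the maps [tau x], multiplication of [S^1] on
    one fixed side by the generator [x].  They preserve a finitely additive
    probability [mu], the image of an invariant mean of [S], and the Markov
    matrix is [M s t], the proportion of the [x] with [tau x s = t].  The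
    theorem is therefore a case of [invariant_walk_spectral_radius], which
    concerns any finite family of [mu]-preserving maps of a set.  Suppose that
    [M] is defined on l2 and has spectral radius below 1.

    Analysis.  The matrix is nonnegative, so everything happens over the reals,
    and [(lambda - M)^-1] is a bounded operator for every real [lambda >= 1].
    It is positive for large [lambda], because [M] is bounded
    ([positive_sq_bounded]), and positivity propagates down to [lambda = 1]
    along the half-line ([resolvent_positive_at1]): if [P] is the positive
    resolvent at [a] and [b] is slightly smaller, then [w = (b - M)^-1 u]
    satisfies [w = P u + (a - b) P w], so its negative part is dominated by a
    contraction of itself and vanishes ([superharmonic_ge0]).  Consequently the
    bounded operator [(1 - M)^-1] dominates all the partial sums
    [1 + M + ... + M^(n-1)] ([neumann_sum_le_resolvent]).  This replaces the
    spectral radius formula.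

    Amenability.  For every finite family of [mu]-preserving maps [sigma] there
    is a summable density [f] whose image under each [sigma] is
    close to [f] in l1; in particular the total of the positive part of
    [f - f o sigma] is at most half of the mass of [f]
    ([exists_almost_invariant_density]).  Otherwise the theorem of Hahn and
    Banach yields bounded functions [h_i] such that the sum over [i] of
    [h_i (sigma_i t) - h_i t] is bounded below by a positive constant, although
    its mean with respect to [mu] is 0 ([invariant_mean_no_drift]).

    Contradiction.  Take for the maps [sigma] all words of length at most [n] in
    the [tau x], and let [g] be the square root of [f].  Since
    [g t * g (sigma t)] is at least the minimum of [f t] and [f (sigma t)],
    the inner product of [g o sigma] and [g] is at least half of the square
    norm of [g].  Now [<g M^k, g>] is an average of such inner products over
    the words of length [k], so the partial sum of order [n] has inner product
    at least [n / 2] times the square norm of [g] with [g]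
    ([pairing_neumann_sum]); for large [n] this exceeds what the bound of
    [(1 - M)^-1] permits. *)

(** * Extension of sublinear functionals *)

Section HahnBanach.
Variables (R : realType) (V : lmodType R).
Implicit Types (p q : V -> R) (D : set (V * R)).

Definition sublinear p : Prop :=
  (forall x y, p (x + y) <= p x + p y) /\
  (forall a x, 0 <= a -> p (a *: x) <= a * p x).

Definition convex_cone D : Prop :=
  (forall c d, D c -> D d -> D (c.1 + d.1, c.2 + d.2)) /\
  (forall a c, 0 <= a -> D c -> D (a *: c.1, a * c.2)).

Lemma sublinear0 p : sublinear p -> p 0 = 0.
Proof.
move=> [pD pZ]; apply/eqP; rewrite eq_le; apply/andP; split.
  by have := pZ 0 0 (lexx _); rewrite scale0r mul0r.
by have := pD 0 0; rewrite addr0; lra.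
Qed.

Lemma sublinearN p x : sublinear p -> - p (- x) <= p x.
Proof.
by move=> ps; have [pD _] := ps; have := pD x (- x); rewrite subrr sublinear0//; lra.
Qed.

Lemma sublinearZ p a x : sublinear p -> 0 <= a -> p (a *: x) = a * p x.
Proof.
move=> ps; rewrite [0 <= a]le_eqVlt => /orP[/eqP<-|a0].
  by rewrite scale0r mul0r sublinear0.
apply/eqP; rewrite eq_le (ps.2 _ _ (ltW a0))/=.
have := ps.2 a^-1 (a *: x); rewrite scalerA mulVf ?gt_eqF// scale1r.
rewrite invr_ge0 => /(_ (ltW a0)).
by move=> h; rewrite mulrC -ler_pdivlMr// mulrC.
Qed.

(** Lowering [p] by the constraints [c.2 <= l c.1]: the infimum over [c] in
    [D] of [p (x + c.1) - c.2] is again sublinear.  It serves twice, for the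
    cone of the final theorem and, with [D] a half-line, to show that minimal
    sublinear functionals are additive. *)
Lemma sublinear_shift p D : sublinear p -> convex_cone D -> D !=set0 ->
  (forall c, D c -> c.2 <= p c.1) ->
  exists q, [/\ sublinear q, forall x, q x <= p x &
    forall c, D c -> q (- c.1) <= - c.2].
Proof.
move=> ps [DD DZ] D0 Dp.
pose Z x := [set p (x + c.1) - c.2 | c in D].
have lbZ x : lbound (Z x) (- p (- x)).
  move=> _ [c Dc <-]; have := Dp _ Dc; have := ps.1 (x + c.1) (- x).
  by rewrite addrAC subrr add0r; lra.
have Z0 x : Z x !=set0 by case: D0 => c Dc; exists (p (x + c.1) - c.2), c.
have hZ x : has_lbound (Z x) by exists (- p (- x)).
pose q x := inf (Z x).
have qle x c : D c -> q x <= p (x + c.1) - c.2.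
  by move=> Dc; apply: ge_inf; [exact: hZ|exists c].
have qge y x : (forall c, D c -> y <= p (x + c.1) - c.2) -> y <= q x.
  by move=> h; apply: lb_le_inf; [exact: Z0|move=> _ [c Dc <-]; exact: h].
have D00 : D (0, 0).
  by have [c Dc] := D0; have := DZ 0 c (lexx _) Dc; rewrite scale0r mul0r.
have qp x : q x <= p x by have := qle x _ D00; rewrite addr0 subr0.
exists q; split=> //; last first.
  by move=> c Dc; have := qle (- c.1) _ Dc; rewrite addNr sublinear0// sub0r.
split=> [x y|a x].
  rewrite -lerBlDr; apply: (qge) => c Dc; rewrite lerBlDr -lerBlDl.
  apply: (qge) => d Dd; rewrite lerBlDr.
  have /= := qle (x + y) _ (DD _ _ Dc Dd); have := ps.1 (x + c.1) (y + d.1).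
  by rewrite [(x + y) + _]addrACA; lra.
rewrite [0 <= a]le_eqVlt => /orP[/eqP<-|a0].
  by rewrite scale0r mul0r; have := qp 0; rewrite (sublinear0 ps).
rewrite mulrC -ler_pdivrMr//; apply: (qge) => c Dc; rewrite ler_pdivrMr//.
have /= := qle (a *: x) _ (DZ a _ (ltW a0) Dc).
by rewrite -scalerDr (sublinearZ _ ps (ltW a0)); lra.
Qed.

(** Zorn applies since the pointwise infimum of a chain of sublinear
    functionals below [p] is finite, being at least [- p (- x)], and
    subadditive because two members of a chain can be replaced by the smaller
    one. *)
Lemma exists_minimal_sublinear p : sublinear p ->
  exists q, [/\ sublinear q, forall x, q x <= p x &
    forall r, sublinear r -> (forall x, r x <= q x) -> r = q].
Proof.
move=> ps.
pose T := {q : V -> R | sublinear q /\ forall x, q x <= p x}.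
pose t0 : T := exist _ p (conj ps (fun x => lexx _)).
pose le : rel T := fun s t => `[< forall x, sval t x <= sval s x >].
have [||A Atot|t tmax] := @ZL_preorder T t0 le.
- by move=> t; apply/asboolP.
- move=> r s t /asboolP rs /asboolP st; apply/asboolP => x.
  exact: le_trans (st x) (rs x).
- have [A0|/set0P/negP] := pselect (A !=set0); last first.
    by rewrite negbK => /eqP->; exists t0.
  pose Z x := [set sval s x | s in A].
  have hZ x : has_lbound (Z x).
    exists (- p (- x)) => _ [[s [ss sp]] _ <-] /=.
    by have := sublinearN x ss; have := sp (- x); lra.
  have Z0 x : Z x !=set0 by case: A0 => s As; exists (sval s x), s.
  pose q x := inf (Z x).
  have qle x s : A s -> q x <= sval s x.
    by move=> As; apply: ge_inf; [exact: hZ|exists s].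
  have qge y x : (forall s, A s -> y <= sval s x) -> y <= q x.
    by move=> h; apply: lb_le_inf; [exact: Z0|move=> _ [s As <-]; exact: h].
  have qs : sublinear q.
    split=> [x y|a x].
      rewrite -lerBlDr; apply: (qge) => s As; rewrite lerBlDr -lerBlDl.
      apply: (qge) => t At; rewrite lerBlDl.
      have [/asboolP st|/asboolP ts] := Atot _ _ As At.
        apply: le_trans (qle _ _ At) _.
        by have := (svalP t).1.1 x y; have := st x; lra.
      apply: le_trans (qle _ _ As) _.
      by have := (svalP s).1.1 x y; have := ts y; lra.
    rewrite [0 <= a]le_eqVlt => /orP[/eqP<-|a0].
      case: A0 => s As; rewrite scale0r mul0r.
      by have := qle 0 _ As; rewrite (sublinear0 (svalP s).1).
    rewrite mulrC -ler_pdivrMr//; apply: (qge) => s As; rewrite ler_pdivrMr//.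
    have := qle (a *: x) _ As.
    by rewrite (sublinearZ _ (svalP s).1 (ltW a0)) mulrC.
  have qp x : q x <= p x.
    by case: A0 => s As; apply: le_trans (qle x _ As) ((svalP s).2 x).
  by exists (exist _ q (conj qs qp)) => s As; apply/asboolP => x; exact: qle.
exists (sval t); have [ts tp] := svalP t; split=> // r rs rt.
have rp x : r x <= p x by exact: le_trans (rt x) (tp x).
apply/funext => x; apply/eqP; rewrite eq_le rt/=.
have /asboolP := tmax (exist _ r (conj rs rp)) (asboolT rt).
exact.
Qed.

(** Shifting [q] along the half-line through [y] gives a functional below [q],
    hence equal to [q] by minimality; its value at [- y] is at most [- q y],
    so [q x <= q (x + y) - q y]. *)
Lemma minimal_sublinear_linear q : sublinear q ->
  (forall r, sublinear r -> (forall x, r x <= q x) -> r = q) ->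
  linear_for *%R q.
Proof.
move=> qs qmin.
have qD x y : q (x + y) = q x + q y.
  apply/eqP; rewrite eq_le qs.1/=.
  pose D := [set (t *: y, t * q y) | t in [set t : R | 0 <= t]].
  have [|||r [rs rq rD]] := @sublinear_shift q D qs.
  - split=> [_ _ [s s0 <-] [t t0 <-]|a _ a0 [t t0 <-]] /=.
      by exists (s + t); [exact: addr_ge0|rewrite scalerDl mulrDl].
    by exists (a * t); [exact: mulr_ge0|rewrite scalerA mulrA].
  - by exists (0 *: y, 0 * q y), 0; rewrite /= ?lexx.
  - by move=> _ [t t0 <-] /=; rewrite sublinearZ.
  have {}rD : r (- y) <= - q y.
    have := rD (1 *: y, 1 * q y); rewrite /= scale1r mul1r; apply.
    by exists 1; rewrite /= ?scale1r ?mul1r.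
  rewrite (qmin _ rs rq) in rD.
  by have := qs.1 (x + y) (- y); rewrite addrK; lra.
have qN x : q (- x) = - q x.
  by have := qD x (- x); rewrite subrr sublinear0//; lra.
move=> a u v; rewrite qD; congr (_ + _).
have [a0|/ltW a0] := leP 0 a; first by rewrite sublinearZ.
have := @sublinearZ q (- a) u qs; rewrite oppr_ge0 => /(_ a0).
by rewrite scaleNr qN mulNr => /oppr_inj.
Qed.

(** The separation form of the theorem: a dominated linear functional can in
    addition be required to be at least [c.2] on [c.1], for a convex cone of
    pairs [c] compatible with [p]. *)
Theorem hahn_banach_cone p D : sublinear p -> convex_cone D -> D !=set0 ->
  (forall c, D c -> c.2 <= p c.1) ->
  exists l : V -> R, [/\ linear_for *%R l, forall x, l x <= p x &
    forall c, D c -> c.2 <= l c.1].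
Proof.
move=> ps Dc D0 Dp; have [q [qs qp qD]] := sublinear_shift ps Dc D0 Dp.
have [l [ls lq lmin]] := exists_minimal_sublinear qs.
have ll := minimal_sublinear_linear ls lmin.
exists l; split=> [//|x|c /qD qc]; first exact: le_trans (lq x) (qp x).
have := lq (- c.1); have := ll (-1) c.1 0.
by rewrite addr0 scaleN1r mulN1r (sublinear0 ls) addr0 => ->; lra.
Qed.

End HahnBanach.

(** * Unordered sums and the space l1 *)

Section UnorderedSums.
Variable R : realType.
Implicit Types T : choiceType.

Lemma le_esum_term T (a : T -> \bar R) t : (forall i, 0 <= a i)%E ->
  (a t <= \esum_(i in [set: T]) a i)%E.
Proof.
move=> a0; rewrite -(@esum_set1 _ _ t a)//; apply: esum_ge.
rewrite esum_set1//; exists [set t]; last by rewrite fsbig_set1.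
by split=> //; exact: finite_set1.
Qed.

Lemma esumT1 T (a : T -> \bar R) t : (0 <= a t)%E ->
  (forall i, i != t -> a i = 0%E) -> \esum_(i in [set: T]) a i = a t.
Proof.
move=> at0 a0; rewrite -(@esum_set1 _ _ t a)// [RHS]esum_mkcond.
apply: eq_esum => i _; case: ifPn => //; rewrite notin_setE /= => it.
by apply: a0; apply/eqP.
Qed.

Lemma esumZ T (c : R) (a : T -> \bar R) : 0 <= c -> (forall i, 0 <= a i)%E ->
  \esum_(i in [set: T]) (c%:E * a i)%E = (c%:E * \esum_(i in [set: T]) a i)%E.
Proof.
move=> c0 a0.
have le (b : T -> \bar R) (d : R) : 0 <= d -> (forall i, 0 <= b i)%E ->
    (\esum_(i in [set: T]) (d%:E * b i) <= d%:E * \esum_(i in [set: T]) b i)%E.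
  move=> d0 b0; apply: ge_ereal_sup => _ [X [finX _] <-].
  rewrite -ge0_mule_fsumr//; apply: lee_wpmul2l; first by rewrite lee_fin.
  by apply: esum_ge; exists X.
apply/eqP; rewrite eq_le le//=.
move: c0; rewrite [0 <= c]le_eqVlt => /orP[/eqP<-|c0].
  by rewrite mul0e esum_ge0// => i _; rewrite mul0e.
have ca0 i : (0 <= c%:E * a i)%E by rewrite mule_ge0// lee_fin ltW.
have ci0 : 0 <= c^-1 by rewrite invr_ge0 ltW.
rewrite -lee_pdivlMl//; apply: le_trans (le _ _ ci0 ca0).
by apply: le_esum => i _; rewrite muleA -EFinM mulVf ?gt_eqF// mul1e.
Qed.

(** Tonelli for two unordered sums: both sides are the sum over pairs. *)
Lemma esum_exchange T1 T2 (a : T1 -> T2 -> \bar R) :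
  (forall i j, 0 <= a i j)%E ->
  \esum_(i in [set: T1]) \esum_(j in [set: T2]) a i j =
  \esum_(j in [set: T2]) \esum_(i in [set: T1]) a i j.
Proof.
move=> a0; rewrite !esum_esum//.
rewrite (reindex_esum ([set: T2] `*`` fun=> [set: T1]) _ (fun x => (x.2, x.1)))//.
split=> //=; first by move=> [i1 i2] [j1 j2] /= _ _ [] -> ->.
by move=> [i1 i2] _ /=; exists (i2, i1).
Qed.

Lemma esum_finType (I : finType) (a : I -> \bar R) : (forall i, 0 <= a i)%E ->
  \esum_(i in [set: I]) a i = (\sum_i a i)%E.
Proof.
move=> a0; rewrite -[in LHS](set_mem_set [set: I]) esum_fset//.
rewrite fsbig_finite//=; apply: perm_big; apply: uniq_perm.
- exact: fset_uniq.
- exact: index_enum_uniq.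
- by move=> i; rewrite in_fset_set// mem_index_enum mem_set//= mem_set.
Qed.

Lemma esum_finX (I : finType) T (a : I * T -> \bar R) : (forall k, 0 <= a k)%E ->
  \esum_(k in [set: I * T]) a k = (\sum_i \esum_(t in [set: T]) a (i, t))%E.
Proof.
move=> a0; rewrite -esum_finType => [|i]; last by rewrite esum_ge0.
rewrite esum_esum//; rewrite (_ : _ `*`` _ = setT); last by apply/seteqP; split.
by apply: eq_esum => -[].
Qed.

End UnorderedSums.

Section L1.
Variables (R : realType) (K : choiceType).

Definition l1_pred : {pred K -> R} :=
  fun v => `[< (\esum_(k in [set: K]) `|v k|%:E < +oo)%E >].

Lemma l1_closed : GRing.subsemimod_closed l1_pred.
Proof.
split; first split.
- by apply/asboolP; rewrite esum1// => k _; rewrite normr0.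
- move=> u v /asboolP uoo /asboolP voo; apply/asboolP.
  apply: (@le_lt_trans _ _ (\esum_(k in [set: K]) (`|u k|%:E + `|v k|%:E))%E).
    by apply: le_esum => k _; rewrite -EFinD lee_fin ler_normD.
  by rewrite esumD// lte_add_pinfty.
- move=> a u /asboolP uoo; apply/asboolP.
  rewrite (eq_esum (b := fun k => (`|a|%:E * `|u k|%:E)%E)); last first.
    by move=> k _; rewrite -EFinM -normrM.
  by rewrite esumZ// lte_mul_pinfty.
Qed.

HB.instance Definition _ :=
  GRing.isSubmodClosed.Build R (K -> R) l1_pred l1_closed.

(** Bundled so that l1 is an [lmodType], as the extension theorem demands. *)
Record l1 := L1 { l1_fun : K -> R; l1P : l1_fun \in l1_pred }.

HB.instance Definition _ := [isSub for l1_fun].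
HB.instance Definition _ := [Choice of l1 by <:].
HB.instance Definition _ := [SubChoice_isSubLmodule of l1 by <:].

Lemma l1_funD u v k : l1_fun (u + v) k = l1_fun u k + l1_fun v k.
Proof. by rewrite -[l1_fun (u + v)]/(\val (u + v)) raddfD. Qed.

Lemma l1_funN u k : l1_fun (- u) k = - l1_fun u k.
Proof. by rewrite -[l1_fun (- u)]/(\val (- u)) raddfN. Qed.

Lemma l1_funZ a u k : l1_fun (a *: u) k = a * l1_fun u k.
Proof. by rewrite -[l1_fun (a *: u)]/(\val (a *: u)) linearZ. Qed.

Lemma l1_fun_sum (I : finType) (F : I -> l1) k :
  l1_fun (\sum_i F i) k = \sum_i l1_fun (F i) k.
Proof.
by rewrite -[l1_fun (\sum_i F i)]/(\val (\sum_i F i)) raddf_sum fct_sumE.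
Qed.

Definition l1_norm (v : l1) : R := fine (\esum_(k in [set: K]) `|l1_fun v k|%:E).

Lemma l1_normE (v : l1) :
  (l1_norm v)%:E = \esum_(k in [set: K]) `|l1_fun v k|%:E.
Proof. by rewrite fineK// ge0_fin_numE ?esum_ge0//; have /asboolP := l1P v. Qed.

Lemma l1_norm_sublinear : sublinear l1_norm.
Proof.
split=> [u v|a u a0].
  rewrite -lee_fin EFinD !l1_normE -esumD//.
  by apply: le_esum => k _; rewrite -EFinD lee_fin l1_funD ler_normD.
rewrite -lee_fin EFinM !l1_normE -esumZ//.
by apply: le_esum => k _; rewrite -EFinM lee_fin l1_funZ normrM ger0_norm.
Qed.

Lemma l1_unit_proof (k : K) : (fun i => (i == k)%:R : R) \in l1_pred.
Proof.
apply/asboolP; rewrite (@esumT1 _ _ _ k) ?eqxx ?normr1 ?ltry//.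
by move=> i /negPf->; rewrite normr0.
Qed.

Definition l1_unit k : l1 := L1 (l1_unit_proof k).

Lemma l1_norm_unit k : l1_norm (l1_unit k) = 1.
Proof.
rewrite /l1_norm (@esumT1 _ _ _ k) /= ?eqxx ?normr1//.
by move=> i /negPf->; rewrite normr0.
Qed.

End L1.

(** * Invariant means have no drift *)

Section InvariantMeans.
Variables (R : realType) (T : choiceType) (mu : set T -> R).
Hypothesis mu_fap : finitely_additive_probability mu.

Lemma fap0 : mu set0 = 0.
Proof.
by have [_ _ muD] := mu_fap; have := muD set0 set0 (setI0 _); rewrite setU0; lra.
Qed.

Lemma fap_preimage (K : finType) (kappa : T -> K) (P : pred K) :
  mu [set t | P (kappa t)] = \sum_(c | P c) mu [set t | kappa t = c].
Proof.
have [_ _ muD] := mu_fap.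
have mu_seq (r : seq K) : uniq r ->
    mu [set t | kappa t \in r] = \sum_(c <- r) mu [set t | kappa t = c].
  elim: r => [_|c r ih /= /andP[cr ur]].
    by rewrite big_nil -fap0; congr mu; apply/seteqP; split.
  rewrite big_cons -ih// -muD.
    congr mu; apply/seteqP; split=> t /=; rewrite inE.
      by move=> /orP[/eqP|]; [left|right].
    by case=> [->|->]; rewrite ?eqxx ?orbT.
  by apply/seteqP; split=> t //= [-> cr']; rewrite cr' in cr.
rewrite -big_enum -mu_seq ?enum_uniq//.
by congr mu; apply/seteqP; split=> t /=; rewrite mem_enum.
Qed.

(** Change of variables for a function with finitely many values. *)
Lemma fap_expectation (K : finType) (kappa : T -> K) N (f : K -> 'I_N) :
  \sum_c mu [set t | kappa t = c] * (f c)%:R =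
  \sum_(v < N) mu [set t | f (kappa t) = v] * v%:R.
Proof.
rewrite (partition_big f xpredT)//=; apply: eq_bigr => v _.
transitivity ((\sum_(c | f c == v) mu [set t | kappa t = c]) * v%:R).
  by rewrite mulr_suml; apply: eq_bigr => c /eqP->.
congr (_ * _); rewrite -(fap_preimage kappa (fun c => f c == v)).
by congr mu; apply/seteqP; split=> t /= /eqP.
Qed.

Variables (I : finType) (sigma : I -> T -> T).
Hypothesis mu_inv : forall i Y, mu [set t | Y (sigma i t)] = mu Y.

(** The values of all the [k i t] and [k i (sigma i t)] define a map [kappa]
    into a finite type, so the two sides can be integrated as finite sums.
    Invariance gives them the same integral, whereas the strict inequality
    between integers would separate the integrals by at least 1. *)
Lemma invariant_mean_no_drift_nat N (k : I -> T -> 'I_N) :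
  ~ forall t, (\sum_i k i t < \sum_i k i (sigma i t))%N.
Proof.
move=> kdrift; have [mu0 mu1 _] := mu_fap.
pose kappa t := ([ffun i => k i t], [ffun i => k i (sigma i t)]).
have mean0 : \sum_c mu [set t | kappa t = c] * (\sum_i (c.1 i)%:R) =
             \sum_c mu [set t | kappa t = c] * (\sum_i (c.2 i)%:R).
  under eq_bigr do rewrite mulr_sumr.
  under [RHS]eq_bigr do rewrite mulr_sumr.
  rewrite exchange_big [RHS]exchange_big /=; apply: eq_bigr => i _.
  rewrite (fap_expectation kappa (fun c => c.1 i)).
  rewrite (fap_expectation kappa (fun c => c.2 i)); apply: eq_bigr => v _.
  congr (_ * _); transitivity (mu [set t | k i t = v]).
    by congr mu; apply/seteqP; split=> t /=; rewrite ffunE.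
  rewrite -(mu_inv i).
  by congr mu; apply/seteqP; split=> t /=; rewrite ffunE.
have : \sum_c mu [set t | kappa t = c] * (\sum_i (c.1 i)%:R + 1) <=
       \sum_c mu [set t | kappa t = c] * (\sum_i (c.2 i)%:R).
  apply: ler_sum => c _.
  have [[t tc]|/set0P/negP] := pselect ([set t | kappa t = c] !=set0).
    apply: ler_wpM2l => //; rewrite -!natr_sum natr1 ler_nat -tc.
    have := kdrift t; congr (_ < _)%N; apply: eq_bigr => i _; by rewrite ffunE.
  by rewrite negbK => /eqP->; rewrite fap0 !mul0r.
under eq_bigr do rewrite mulrDr mulr1.
rewrite big_split/= mean0 -(fap_preimage kappa xpredT).
have -> : [set t | xpredT (kappa t)] = setT by apply/seteqP; split.
by rewrite mu1; lra.
Qed.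

(** Rescaling [h] by a large [n] and rounding down costs at most [#|I|] in the
    sum over [i], less than the drift [n * eps], so that bounded real functions
    reduce to functions with finitely many integer values. *)
Lemma invariant_mean_no_drift (h : I -> T -> R) (eps : R) : 0 < eps ->
  (forall i t, `|h i t| <= 1) ->
  ~ forall t, eps <= \sum_i (h i (sigma i t) - h i t).
Proof.
move=> eps0 h1 hdrift.
pose n := (Num.truncn (#|I|%:R / eps)).+1.
have epsn : #|I|%:R < n%:R * eps by rewrite -ltr_pdivrMr// truncnS_gt.
(* the shift by 1 makes the rounded values natural numbers *)
pose H i t := (h i t + 1) * n%:R.
have H0 i t : 0 <= H i t.
  by apply: mulr_ge0 => //; have := h1 i t; rewrite ler_norml => /andP[]; lra.
have Hn i t : H i t <= (n.*2)%:R.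
  have := h1 i t; rewrite ler_norml -mul2n natrM => /andP[_ h2].
  by apply: ler_wpM2r => //; lra.
have kN i t : (Num.truncn (H i t) < n.*2.+1)%N.
  by rewrite ltnS -(ler_nat R); apply: le_trans (Hn i t); rewrite truncn_le.
apply: (@invariant_mean_no_drift_nat _ (fun i t => Ordinal (kN i t))) => t.
rewrite /= -(ltr_nat R) !natr_sum.
have le1 : \sum_i (Num.truncn (H i t))%:R <= \sum_i H i t.
  by apply: ler_sum => i _; rewrite truncn_le.
have le2 : \sum_i (H i (sigma i t) - 1) <=
    \sum_i (Num.truncn (H i (sigma i t)))%:R :> R.
  by apply: ler_sum => i _; rewrite lerBlDr natr1 ltW// truncnS_gt.
have eqH : \sum_i H i (sigma i t) =
    \sum_i H i t + n%:R * \sum_i (h i (sigma i t) - h i t).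
  by rewrite mulr_sumr -big_split; apply: eq_bigr => i _; rewrite /H /=; ring.
move: le2; rewrite sumrB sumr_const eqH.
have : n%:R * eps <= n%:R * \sum_i (h i (sigma i t) - h i t).
  by apply: ler_wpM2l => //; exact: hdrift.
by lra.
Qed.

End InvariantMeans.

(** * Almost invariant densities *)

Section AlmostInvariantDensities.
Variables (R : realType) (T : choiceType).
Implicit Types (f g : T -> R) (s : T -> T).

Definition mass f : \bar R := \esum_(t in [set: T]) (f t)%:E.

(** Not normalised: the summable nonnegative functions form a cone, and it is
    the cone that the separation argument uses. *)
Definition density f : Prop := (forall t, 0 <= f t) /\ (mass f < +oo)%E.

Definition pushforward s f (u : T) : R :=
  fine (\esum_(t in [set: T]) (f t * (s t == u)%:R)%:E).

Lemma mass_ge0 f : (forall t, 0 <= f t) -> (0 <= mass f)%E.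
Proof. by move=> f0; apply: esum_ge0 => t _; rewrite lee_fin. Qed.

Lemma massE f : density f -> mass f = (fine (mass f))%:E.
Proof. by move=> [f0 foo]; rewrite fineK// ge0_fin_numE// mass_ge0. Qed.

Lemma pushforwardE s f u : density f ->
  (pushforward s f u)%:E = \esum_(t in [set: T]) (f t * (s t == u)%:R)%:E.
Proof.
move=> [f0 foo]; rewrite fineK// ge0_fin_numE; last first.
  by apply: esum_ge0 => t _; rewrite lee_fin mulr_ge0.
apply: le_lt_trans foo; apply: le_esum => t _; rewrite lee_fin.
by rewrite ler_piMr//; case: eqP.
Qed.

Lemma densityD f g : density f -> density g -> density (f \+ g).
Proof.
move=> [f0 foo] [g0 goo]; split=> [t|]; first exact: addr_ge0.
rewrite /mass; under eq_esum do rewrite EFinD.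
by rewrite esumD ?lte_add_pinfty// => t _; rewrite lee_fin.
Qed.

Lemma massD f g : density f -> density g -> mass (f \+ g) = (mass f + mass g)%E.
Proof.
move=> [f0 _] [g0 _]; rewrite /mass; under eq_esum do rewrite EFinD.
by rewrite esumD// => t _; rewrite lee_fin.
Qed.

Lemma massZ a f : 0 <= a -> density f -> mass (fun t => a * f t) = (a%:E * mass f)%E.
Proof.
move=> a0 [f0 _]; rewrite /mass; under eq_esum do rewrite EFinM.
by rewrite esumZ// => t; rewrite lee_fin.
Qed.

Lemma densityZ a f : 0 <= a -> density f -> density (fun t => a * f t).
Proof.
move=> a0 df; split=> [t|]; first by apply: mulr_ge0 => //; exact: df.1.
by rewrite massZ// lte_mul_pinfty//; case: df.
Qed.

Lemma pushforwardD s f g u : density f -> density g ->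
  pushforward s (f \+ g) u = pushforward s f u + pushforward s g u.
Proof.
move=> df dg; apply: EFin_inj; rewrite EFinD !pushforwardE//; last exact: densityD.
rewrite -esumD; last 2 first.
- by move=> t _; rewrite lee_fin mulr_ge0//; case: df.
- by move=> t _; rewrite lee_fin mulr_ge0//; case: dg.
by apply: eq_esum => t _; rewrite -EFinD mulrDl.
Qed.

Lemma pushforwardZ s a f u : 0 <= a -> density f ->
  pushforward s (fun t => a * f t) u = a * pushforward s f u.
Proof.
move=> a0 df; apply: EFin_inj; rewrite EFinM !pushforwardE//; last exact: densityZ.
rewrite -esumZ//; last by move=> t; rewrite lee_fin mulr_ge0//; case: df.
by apply: eq_esum => t _; rewrite -EFinM mulrA.
Qed.

Lemma mass_delta t : mass (fun v => (v == t)%:R) = 1%E.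
Proof.
rewrite /mass (@esumT1 _ _ _ t) ?eqxx//.
by move=> i /negPf->.
Qed.

Lemma density_delta t : density (fun v => (v == t)%:R).
Proof. by split=> //; rewrite mass_delta ltry. Qed.

Lemma pushforward_delta s t u :
  pushforward s (fun v => (v == t)%:R) u = (s t == u)%:R.
Proof.
rewrite /pushforward (@esumT1 _ _ _ t) ?eqxx ?mul1r//.
by move=> i /negPf->; rewrite mul0r.
Qed.

(** The inequality is checked on each fibre of [s].  Over [u], either no point
    [t] has [f t > f u] and the left side vanishes, or some [t0] has; then [f u]
    is subtracted at least once on the left, at [t0], and the remaining terms
    are bounded by [f t]. *)
Lemma excess_le_pushforward s f : density f ->
  (\esum_(t in [set: T]) (Num.max 0 (f t - f (s t)))%:E <=
   \esum_(u in [set: T]) `|pushforward s f u - f u|%:E)%E.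
Proof.
move=> df; have [f0 _] := df.
pose e t u := Num.max 0 (f t - f u) * (s t == u)%:R.
have e0 t u : 0 <= e t u by rewrite /e mulr_ge0// le_max lexx.
rewrite (eq_esum (b := fun t => \esum_(u in [set: T]) (e t u)%:E)); last first.
  move=> t _; rewrite (@esumT1 _ _ _ (s t)) ?lee_fin// /e ?eqxx ?mulr1//.
  by move=> u; rewrite eq_sym => /negPf->; rewrite mulr0.
rewrite esum_exchange; last by move=> t u; rewrite lee_fin.
apply: le_esum => u _.
have [[t0 [st0 ft0]]|noex] := pselect (exists t0, s t0 = u /\ f u < f t0); last first.
  rewrite esum1 ?lee_fin// => t _; rewrite /e; case: eqP => [stu|]; last by rewrite mulr0.
  rewrite mulr1 max_l// subr_le0 leNgt; apply/negP => fut.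
  by apply: noex; exists t.
suff : (\esum_(t in [set: T]) (e t u)%:E + (f u)%:E <= (pushforward s f u)%:E)%E.
  rewrite -leeBrDr// -EFinB => /le_trans; apply.
  by rewrite lee_fin ler_norm.
rewrite pushforwardE// -[X in (_ + X)%E](_ :
    \esum_(t in [set: T]) (f u * (t == t0)%:R)%:E = _)%E; last first.
  rewrite (@esumT1 _ _ _ t0) ?eqxx ?mulr1 ?lee_fin//.
  by move=> i /negPf->; rewrite mulr0.
rewrite -esumD; last 2 first.
- by move=> t _; rewrite lee_fin.
- by move=> t _; rewrite lee_fin mulr_ge0.
apply: le_esum => t _; rewrite -EFinD lee_fin /e.
have [->|_] := eqVneq t t0.
  have h : 0 <= f t0 - f u by rewrite subr_ge0 ltW.
  by rewrite st0 eqxx !mulr1 (max_r h) subrK.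
rewrite mulr0 addr0; apply: ler_wpM2r => //.
by rewrite ge_max f0 lerBlDr lerDl f0.
Qed.

Variables (mu : set T -> R).
Hypothesis mu_fap : finitely_additive_probability mu.
Variables (I : finType) (sigma : I -> T -> T).
Hypothesis mu_inv : forall i Y, mu [set t | Y (sigma i t)] = mu Y.

(** If every density is moved by an l1 distance at least [eps] times its mass,
    then the displacements of the densities form a cone on which a linear
    functional of norm 1 is at least [eps] times the mass.  Its values on unit
    vectors are bounded functions with a drift, as the point masses show. *)
Theorem exists_almost_invariant_density (eps : R) : 0 < eps ->
  exists f, [/\ density f, (0 < mass f)%E & forall i,
    (\esum_(t in [set: T]) (Num.max 0 (f t - f (sigma i t)))%:E <=
     eps%:E * mass f)%E].
Proof.
move=> eps0; apply: contrapT => no_f.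
pose dist i f := \esum_(u in [set: T]) `|pushforward (sigma i) f u - f u|%:E.
have dist0 i f : (0 <= dist i f)%E by apply: esum_ge0 => u _; rewrite lee_fin.
have far f : density f -> (eps%:E * mass f <= \sum_i dist i f)%E.
  move=> df; have := mass_ge0 df.1; rewrite le_eqVlt => /orP[/eqP<-|mf].
    by rewrite mule0 sume_ge0.
  rewrite leNgt; apply/negP => lt; apply: no_f; exists f; split=> // i.
  apply: le_trans (excess_le_pushforward _ df) (le_trans _ (ltW lt)).
  by rewrite (bigD1 i)//= leeDl// sume_ge0.
(* coordinate [(i, u)] is the change at [u] when [f] is pushed by [sigma i] *)
pose D : set (l1 R (I * T)%type * R) := [set c | exists f, [/\ density f,
  forall k, l1_fun c.1 k = pushforward (sigma k.1) f k.2 - f k.2 &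
  c.2 = eps * fine (mass f)]].
have d0 : density (fun _ : T => 0 : R).
  by split=> //; rewrite /mass esum1 ?ltry.
have [||||l [ll ln lD]] := @hahn_banach_cone R _ (@l1_norm R _) D.
- exact: l1_norm_sublinear.
- split=> [c d [f [df cf c2]] [g [dg dg' d2]]|a c a0 [f [df cf c2]]].
    exists (f \+ g); split; first exact: densityD.
      by move=> k; rewrite l1_funD pushforwardD// cf dg' /=; ring.
    rewrite /= massD// c2 d2 fineD; first by ring.
      by rewrite massE.
    by rewrite massE.
  exists (fun t => a * f t); split; first exact: densityZ.
    by move=> k; rewrite l1_funZ pushforwardZ// cf /=; ring.
  by rewrite /= massZ// c2 massE//= mulrCA.
- exists (0, 0), (fun _ => 0); split=> //= [k|].
    by rewrite /pushforward esum1 ?subrr// => t _; rewrite mul0r.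
  by rewrite /mass esum1//= mulr0.
- move=> c [f [df cf ->]]; rewrite -lee_fin EFinM -massE// l1_normE.
  apply: le_trans (far f df) _; rewrite esum_finX//.
  by apply: lee_sum => i _; apply: le_esum => t _; rewrite cf.
have lB x y : l (x - y) = l x - l y.
  by have := ll (-1) y x; rewrite scaleN1r mulN1r [- y + x]addrC => ->; rewrite addrC.
have l0 : l 0 = 0 by rewrite -(subrr 0) lB subrr.
have lDD x y : l (x + y) = l x + l y.
  by have := ll 1 x y; rewrite scale1r mul1r.
pose e i t : l1 R (I * T)%type := l1_unit R (i, t).
apply: (@invariant_mean_no_drift R T mu mu_fap I sigma mu_inv (fun i t => l (e i t)) eps eps0).
  move=> i t; have := ln (e i t); have := ln (- e i t).
  have nN : l1_norm (- e i t) = l1_norm (e i t).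
    by rewrite /l1_norm; congr fine; apply: eq_esum => k _; rewrite l1_funN normrN.
  rewrite nN l1_norm_unit -[- e i t]sub0r lB l0 ler_norml => h1 h2.
  by apply/andP; split; lra.
move=> t.
under eq_bigr do rewrite -lB.
rewrite -(big_morph l lDD l0).
have := lD (\sum_i (e i (sigma i t) - e i t), eps); apply.
exists (fun v => (v == t)%:R); split; first exact: density_delta.
  move=> [j u]; rewrite pushforward_delta l1_fun_sum.
  have eE i v : l1_fun (e i v) (j, u) = ((j == i) && (u == v))%:R by [].
  under eq_bigr do rewrite l1_funD l1_funN !eE.
  rewrite (bigD1 j)//= big1 => [|i /negPf ij].
    by rewrite addr0 eqxx [_ == u]eq_sym.
  by rewrite [j == i]eq_sym ij subrr.
by rewrite mass_delta /= mulr1.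
Qed.

End AlmostInvariantDensities.

(** * Positive operators on real l2 *)

Section PositiveOperators.
Variables (R : realType) (T : choiceType).
Implicit Types (u v w : T -> R) (N P Q : (T -> R) -> T -> R).

Definition sqnorm v : \bar R := \esum_(t in [set: T]) (v t ^+ 2)%:E.

Definition l2 v : Prop := (sqnorm v < +oo)%E.

Lemma sqnorm_ge0 v : (0 <= sqnorm v)%E.
Proof. by apply: esum_ge0 => t _; rewrite lee_fin sqr_ge0. Qed.

Lemma sqnormE v : l2 v -> sqnorm v = (fine (sqnorm v))%:E.
Proof. by move=> v2; rewrite fineK// ge0_fin_numE// sqnorm_ge0. Qed.

Lemma le_sqnorm u v : (forall t, `|u t| <= `|v t|) -> (sqnorm u <= sqnorm v)%E.
Proof.
move=> uv; apply: le_esum => t _; rewrite lee_fin -[u t ^+ 2]real_normK ?num_real//.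
by rewrite -[v t ^+ 2]real_normK ?num_real// lerXn2r ?nnegrE.
Qed.

Lemma le_l2 u v : (forall t, `|u t| <= `|v t|) -> l2 v -> l2 u.
Proof. by move=> uv; apply: le_lt_trans; exact: le_sqnorm. Qed.

Lemma sqnormZ a u : sqnorm (fun t => a * u t) = ((a ^+ 2)%:E * sqnorm u)%E.
Proof.
rewrite -esumZ ?sqr_ge0//; last by move=> t; rewrite lee_fin sqr_ge0.
by apply: eq_esum => t _; rewrite -EFinM exprMn.
Qed.

(** A crude substitute for the triangle inequality, which keeps all estimates
    in terms of square norms. *)
Lemma sqnormD u v :
  (sqnorm (fun t => u t + v t)%R <= 2%:E * sqnorm u + 2%:E * sqnorm v)%E.
Proof.
rewrite -!esumZ//; try by move=> t; rewrite lee_fin sqr_ge0.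
rewrite -esumD; try by move=> t _; rewrite -EFinM lee_fin mulr_ge0 ?sqr_ge0.
apply: le_esum => t _; rewrite -!EFinM -EFinD lee_fin.
by have := sqr_ge0 (u t - v t); rewrite sqrrB sqrrD; lra.
Qed.

Lemma l2Z a u : l2 u -> l2 (fun t => a * u t).
Proof. by move=> u2; rewrite /l2 sqnormZ lte_mul_pinfty// lee_fin sqr_ge0. Qed.

Lemma l2D u v : l2 u -> l2 v -> l2 (fun t => u t + v t).
Proof.
move=> u2 v2; apply: le_lt_trans (sqnormD u v) _.
by rewrite lte_add_pinfty// lte_mul_pinfty.
Qed.

Lemma l2_0 : l2 (fun=> 0).
Proof. by rewrite /l2 /sqnorm esum1// => t _; rewrite expr0n. Qed.

Lemma sqnorm_eq0 v : sqnorm v = 0%E -> forall t, v t = 0.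
Proof.
move=> v0 t; have : (((v t) ^+ 2)%:E <= sqnorm v)%E.
  by apply: (@le_esum_term _ _ (fun t => (v t ^+ 2)%:E)) => i; rewrite lee_fin sqr_ge0.
rewrite v0 lee_fin => h; apply/eqP; rewrite -sqrf_eq0 eq_le h sqr_ge0.
by [].
Qed.

Definition l2_operator N : Prop :=
  (forall v, l2 v -> l2 (N v)) /\
  (forall a u v, l2 u -> l2 v ->
    N (fun t => a * u t + v t) = (fun t => a * N u t + N v t)).

Definition positive N : Prop :=
  forall u, l2 u -> (forall t, 0 <= u t) -> forall t, 0 <= N u t.

(** [C] bounds the square of the operator norm. *)
Definition sq_bounded N (C : R) : Prop :=
  0 <= C /\ forall u, l2 u -> (sqnorm (N u) <= C%:E * sqnorm u)%E.

Lemma l2_operatorZ N a u t : l2_operator N -> l2 u ->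
  N (fun t => a * u t) t = a * N u t.
Proof.
move=> [_ NL] u2.
have N0 : N (fun=> 0) t = 0.
  have := NL 1 (fun=> 0) (fun=> 0) l2_0 l2_0.
  under [X in N X]eq_fun do rewrite mulr0 addr0.
  by move/(congr1 (fun f => f t)); lra.
have := NL a u (fun=> 0) u2 l2_0; under [X in N X]eq_fun do rewrite addr0.
by move=> ->; rewrite N0 addr0.
Qed.

Lemma l2_operator_mono N u v : l2_operator N -> positive N -> l2 u -> l2 v ->
  (forall t, u t <= v t) -> forall t, N u t <= N v t.
Proof.
move=> [N2 NL] N0 u2 v2 uv t.
have := N0 (fun t => -1 * u t + v t) (l2D (l2Z _ u2) v2).
rewrite NL// => /(_ _ t) h; rewrite -subr_ge0 addrC -mulN1r; apply: h => {}t.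
by have := uv t; lra.
Qed.

(** The negative part [z] of [w] satisfies [z <= eta * P z], because [P] is
    positive.  As [eta * P] is a strict contraction, [z] is 0. *)
Lemma superharmonic_ge0 P C eta w : l2_operator P -> positive P ->
  sq_bounded P C -> 0 <= eta -> eta ^+ 2 * C < 1 -> l2 w ->
  (forall t, eta * P w t <= w t) -> forall t, 0 <= w t.
Proof.
move=> PL P0 [C0 PC] eta0 etaC w2 weta.
pose z t := Num.max 0 (- w t).
have z0 t : 0 <= z t by rewrite /z le_max lexx.
have z2 : l2 z.
  apply: le_l2 w2 => t; rewrite ger0_norm// /z ge_max normr_ge0/=.
  by rewrite -normrN ler_norm.
have zP t : z t <= eta * P z t.
  rewrite ge_max mulr_ge0 ?P0//=.
  apply: (@le_trans _ _ (eta * (-1 * P w t))); first by have := weta t; lra.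
  apply: ler_wpM2l => //; rewrite -l2_operatorZ//.
  apply: l2_operator_mono => //; first exact: l2Z.
  by move=> {}t; rewrite mulN1r /z le_max lexx orbT.
have zz : (sqnorm z <= (eta ^+ 2 * C)%:E * sqnorm z)%E.
  apply: (@le_trans _ _ (sqnorm (fun t => eta * P z t))).
    apply: le_sqnorm => t; rewrite ger0_norm// ger0_norm// .
    by rewrite mulr_ge0// P0.
  rewrite sqnormZ [(eta ^+ 2 * C)%:E]EFinM -muleA.
  by apply: lee_wpmul2l; [rewrite lee_fin sqr_ge0|exact: PC].
have zz0 : sqnorm z = 0%E.
  move: zz; rewrite sqnormE// -EFinM lee_fin => zz; congr EFin.
  have : 0 <= fine (sqnorm z) by rewrite fine_ge0// sqnorm_ge0.
  by move: zz etaC; set a := fine _; set b := _ * C; nra.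
move=> t; rewrite -oppr_le0 -(sqnorm_eq0 zz0 t).
by rewrite /z le_max lexx orbT.
Qed.

(** A gliding hump: if there were nonnegative vectors [v n] of square norm at
    most [2^-(n+1)] with images of square norm at least [n], the vector whose
    square is the sum of the squares of the [v n] would lie in l2 and dominate
    every [v n], so that the square norm of its image is at least every [n]. *)
Lemma positive_sq_bounded N : l2_operator N -> positive N ->
  exists C, sq_bounded N C.
Proof.
move=> NL N0; apply: contrapT => unbounded.
have big n : exists v, [/\ forall t, 0 <= v t, (sqnorm v <= (1 / (2 ^ n.+1)%:R)%:E)%E,
    l2 v & (n%:R%:E <= sqnorm (N v))%E].
  (* once [u] is rescaled to square norm [2^-(n+1)], the image keeps square
     norm at least [n] *)
  pose C : R := n%:R * (2 ^ n.+1)%:R.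
  have C0 : 0 <= C by rewrite mulr_ge0.
  have [u [u2 uC]] : exists u, l2 u /\ (C%:E * sqnorm u < sqnorm (N u))%E.
    apply: contrapT => nou; apply: unbounded; exists C; split=> // u u2.
    by rewrite leNgt; apply/negP => uC; apply: nou; exists u.
  pose au t := `|u t|.
  have au2 : l2 au.
    by apply: le_l2 u2 => t; rewrite normr_id.
  have sqau : sqnorm au = sqnorm u.
    by apply: eq_esum => t _; rewrite real_normK ?num_real.
  have Nau : (sqnorm (N u) <= sqnorm (N au))%E.
    have NauP t : `|N u t| <= N au t.
      rewrite ler_norml lerNl -mulN1r -l2_operatorZ//.
      apply/andP; split; apply: l2_operator_mono => //; try exact: l2Z.
        by move=> {}t; rewrite mulN1r /au -normrN ler_norm.
      by move=> {}t; rewrite /au ler_norm.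
    by apply: le_sqnorm => t; apply: le_trans (NauP t) (ler_norm _).
  have su0 : 0 < fine (sqnorm u).
    rewrite lt_neqAle fine_ge0 ?sqnorm_ge0// andbT eq_sym; apply/eqP => su0.
    have {}su0 : sqnorm u = 0%E by rewrite sqnormE// su0.
    have u0 := sqnorm_eq0 su0.
    move: uC; rewrite su0 mule0.
    have -> : u = (fun t => 0 * u t) by apply/funext => t; rewrite u0 mulr0.
    have -> : sqnorm (N (fun t => 0 * u t)) = 0%E.
      by rewrite /sqnorm esum1// => t _; rewrite l2_operatorZ// mul0r expr0n.
    by rewrite ltxx.
  pose a : R := (1 / (2 ^ n.+1)%:R) / fine (sqnorm u).
  have a0 : 0 <= a by rewrite !divr_ge0// ltW.
  have sa : sqnorm (fun t => Num.sqrt a * au t) = (1 / (2 ^ n.+1)%:R)%:E.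
    by rewrite sqnormZ sqr_sqrtr// sqau sqnormE// -EFinM divfK// gt_eqF.
  exists (fun t => Num.sqrt a * au t); split; rewrite ?sa//.
  - by move=> t; apply: mulr_ge0; rewrite ?sqrtr_ge0 ?normr_ge0.
  - exact: (l2Z _ au2).
  - rewrite (_ : N _ = fun t => Num.sqrt a * N au t); last first.
      by apply/funext => t; rewrite l2_operatorZ.
    rewrite sqnormZ sqr_sqrtr//.
    apply: (@le_trans _ _ (a%:E * (C%:E * sqnorm u))%E); last first.
      apply: lee_wpmul2l; first by rewrite lee_fin.
      by apply: le_trans Nau; exact: ltW.
    rewrite sqnormE// -!EFinM lee_fin /a /C le_eqVlt; apply/orP; left; apply/eqP.
    field.
    by rewrite gt_eqF//= pnatr_eq0 expn_eq0.
have [v vP] := choice big.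
have sumV : (\esum_(t in [set: T]) \esum_(n in [set: nat]) (v n t ^+ 2)%:E <= 1)%E.
  rewrite esum_exchange; last by move=> *; rewrite lee_fin sqr_ge0.
  apply: le_trans (epsilon_trick0 xpredT ler01).
  rewrite nneseries_esumT; last by move=> n; rewrite lee_fin divr_ge0.
  by apply: le_esum => n _; have [] := vP n.
have term0 t : (0 <= \esum_(n in [set: nat]) (v n t ^+ 2)%:E)%E.
  by apply: esum_ge0 => n _; rewrite lee_fin sqr_ge0.
have termE t : \esum_(n in [set: nat]) (v n t ^+ 2)%:E =
    (fine (\esum_(n in [set: nat]) (v n t ^+ 2)%:E))%:E.
  rewrite fineK// ge0_fin_numE//; apply: le_lt_trans (ltry 1).
  by apply: le_trans sumV; apply: (le_esum_term _ term0).
pose V t := Num.sqrt (fine (\esum_(n in [set: nat]) (v n t ^+ 2)%:E)).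
have V2 : l2 V.
  apply: le_lt_trans (ltry 1); apply: le_trans sumV; apply: le_esum => t _.
  by rewrite sqr_sqrtr ?fine_ge0// -termE.
have vV n t : v n t <= V t.
  have [v0 _ _ _] := vP n.
  rewrite -(ger0_norm (v0 t)) -sqrtr_sqr ler_wsqrtr// -lee_fin -termE.
  apply: (@le_esum_term _ _ (fun n => (v n t ^+ 2)%:E)) => m.
  by rewrite lee_fin sqr_ge0.
have V0 t : 0 <= V t by exact: sqrtr_ge0.
have NVbig n : (n%:R%:E <= sqnorm (N V))%E.
  have [v0 _ v2 /le_trans] := vP n; apply; apply: le_sqnorm => t.
  by rewrite !ger0_norm ?N0//; apply: l2_operator_mono.
have NV2 := NL.1 _ V2.
have := NVbig (Num.truncn (fine (sqnorm (N V)))).+1.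
by rewrite sqnormE// lee_fin leNgt truncnS_gt.
Qed.

End PositiveOperators.

(** * Positivity of the resolvent *)

Section ResolventPositivity.
Variables (R : realType) (T : choiceType).
Implicit Types (u v w : T -> R) (N P Q : (T -> R) -> T -> R).

Definition resolvent N Q (lambda : R) : Prop :=
  [/\ l2_operator Q, exists C, sq_bounded Q C &
    forall u, l2 u ->
      (forall t, lambda * Q u t - N (Q u) t = u t) /\
      Q (fun t => lambda * u t - N u t) = u].

Lemma resolvent_identity N P Q a b u : resolvent N P a -> resolvent N Q b ->
  l2 u -> forall t, Q u t = (a - b) * P (Q u) t + P u t.
Proof.
move=> [PL _ PR] [QL _ QR] u2 t.
have Qu2 : l2 (Q u) := QL.1 _ u2.
rewrite -{1}(PR _ Qu2).2.
rewrite (_ : (fun t => _) = (fun t => (a - b) * Q u t + u t)).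
  by rewrite PL.2.
by apply/funext => x; rewrite -((QR _ u2).1 x); ring.
Qed.

(** Local boundedness of the resolvent near [b], obtained by absorbing the
    term [(b - a) * Q (P u)] of the resolvent identity in the left side. *)
Lemma resolvent_sq_bounded N P Q a b C : resolvent N P a -> resolvent N Q b ->
  sq_bounded Q C -> 4 * (a - b) ^+ 2 * C <= 1 -> sq_bounded P (4 * C).
Proof.
move=> Pa Qb [C0 QC] abC; split; first by rewrite mulr_ge0.
move=> u u2; have [PL _ _] := Pa; have [QL _ _] := Qb.
have Pu2 := PL.1 _ u2.
have := sqnormD (fun t => (b - a) * Q (P u) t) (Q u).
rewrite -(_ : P u = fun t => _); last first.
  by apply/funext => t; rewrite -(resolvent_identity Qb Pa).
rewrite sqnormZ => h.
have h1 := QC _ Pu2; have h2 := QC _ u2.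
have QPu2 := QL.1 _ Pu2; have Qu2 := QL.1 _ u2.
move: h h1 h2.
rewrite (sqnormE Pu2) (sqnormE QPu2) (sqnormE Qu2) (sqnormE u2).
rewrite -!EFinM -EFinD !lee_fin.
have : 0 <= fine (sqnorm (P u)) by rewrite fine_ge0// sqnorm_ge0.
move: abC.
set p := fine (sqnorm (P u)); set q := fine (sqnorm (Q _)); set r := fine _.
set s := fine _ => abC p0 h1 h2 h3.
have h4 : (b - a) ^+ 2 * q <= (b - a) ^+ 2 * (C * p).
  by apply: ler_wpM2l => //; exact: sqr_ge0.
have h5 : 4 * (a - b) ^+ 2 * C * p <= 1 * p by apply: ler_wpM2r.
have h6 : (b - a) ^+ 2 = (a - b) ^+ 2 by ring.
rewrite h6 in h1 h4; move: h5 h4 h1.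
rewrite (_ : 4 * _ * _ * _ = 4 * ((a - b) ^+ 2 * (C * p))); last by ring.
set x := _ * (C * p); set y := _ * q.
by move: h3; rewrite -[4 * C * s]mulrA; set z := C * s; lra.
Qed.

(** By the resolvent identity, [Q u - (a - b) * P (Q u) = P u >= 0]. *)
Lemma resolvent_positive_step N P Q C a b : resolvent N P a ->
  positive P -> sq_bounded P C -> resolvent N Q b -> b <= a ->
  (a - b) ^+ 2 * C < 1 -> positive Q.
Proof.
move=> Pa P0 PC Qb ba abC u u2 u0; have [PL _ _] := Pa; have [QL _ _] := Qb.
apply: (superharmonic_ge0 PL P0 PC _ abC (QL.1 _ u2)); first by rewrite subr_ge0.
by move=> t; rewrite [leRHS](resolvent_identity Pa Qb u2) lerDl P0.
Qed.

(** Here [b * Q u - N (Q u) = u >= 0], and [N] divided by [b] is a contraction. *)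
Lemma resolvent_positive_large N Q C b : l2_operator N -> positive N ->
  sq_bounded N C -> resolvent N Q b -> 1 <= b -> C < b -> positive Q.
Proof.
move=> NL N0 NC [QL _ QR] b1 Cb u u2 u0.
have b0 : 0 < b by lra.
apply: (@superharmonic_ge0 R T N C b^-1 _ NL N0 NC _ _ (QL.1 _ u2)).
- by rewrite invr_ge0 ltW.
- rewrite exprVn mulrC ltr_pdivrMr ?exprn_gt0// mul1r.
  by apply: lt_le_trans Cb _; rewrite expr2 ler_peMl// ltW.
- move=> t; rewrite mulrC ler_pdivrMr// -subr_ge0 [_ * b]mulrC.
  by rewrite (QR _ u2).1.
Qed.

(** The set [E] of the [a >= 1] at which the resolvent is positive contains all
    large [a].  Near its infimum [m] the resolvents are uniformly bounded, so
    one step of a length depending only on [m] leads from a point of [E] close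
    to [m] to a point of [E] below [m], unless 1 is reached. *)
Theorem resolvent_positive_at1 N Q : l2_operator N -> positive N ->
  (forall a, 1 <= a -> exists P, resolvent N P a) ->
  resolvent N Q 1 -> positive Q.
Proof.
move=> NL N0 res.
pose E := [set a | 1 <= a /\ forall P, resolvent N P a -> positive P].
suff : E 1 by move=> [_]; exact.
have [C NC] := positive_sq_bounded NL N0.
have E_ne : E !=set0.
  exists (C + 1); split=> [|P PC]; first by have [C0 _] := NC; lra.
  apply: (resolvent_positive_large NL N0 NC PC); have [C0 _] := NC; lra.
have E_lb : has_lbound E by exists 1 => a [].
pose m := inf E.
have m1 : 1 <= m by apply: lb_le_inf => // a [].
have [Qm Qmm] := res m m1; have [_ [K QmK] _] := Qmm; have [K0 _] := QmK.
(* small enough for the bound [4 * K] of the resolvents within [eta] of [m],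
   and then for a step of length [2 * eta] *)
pose eta : R := (4 * (K + 1))^-1.
have K1 : 0 < 4 * (K + 1) by lra.
have eta0 : 0 < eta by rewrite invr_gt0.
have etaK : eta ^+ 2 * (16 * K) < 1.
  rewrite exprVn mulrC ltr_pdivrMr ?exprn_gt0// mul1r.
  by have : 0 <= K * K by [exact: mulr_ge0]; lra.
have [a Ea am] := inf_adherent eta0 (conj E_ne E_lb).
have ma : m <= a by exact: ge_inf.
pose b := Num.max 1 (m - eta).
have b1 : 1 <= b by rewrite le_max lexx.
have bm : b <= m by rewrite ge_max m1 lerBlDr lerDl ltW.
have mb : m - eta <= b by rewrite le_max lexx orbT.
have Eb : E b.
  split=> // P Pb; have [Pa Paa] := res a Ea.1.
  have am2 : (a - m) ^+ 2 <= eta ^+ 2.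
    by rewrite lerXn2r ?nnegrE ?subr_ge0// ?ltW//; rewrite -/m in am; lra.
  have h1 : (a - m) ^+ 2 * K <= eta ^+ 2 * K by apply: ler_wpM2r.
  have PaK : sq_bounded Pa (4 * K).
    by apply: (resolvent_sq_bounded Paa Qmm QmK); lra.
  apply: (resolvent_positive_step Paa (Ea.2 _ Paa) PaK Pb); first by lra.
  have ab2 : (a - b) ^+ 2 <= (2 * eta) ^+ 2.
    by rewrite lerXn2r ?nnegrE//; rewrite -/m in am; lra.
  have h2 : (a - b) ^+ 2 * K <= (2 * eta) ^+ 2 * K by apply: ler_wpM2r.
  by rewrite exprMn in h2; lra.
have mb' : m <= b by exact: ge_inf.
suff -> : 1 = b by [].
by move: mb'; rewrite /b; case: (lerP 1 (m - eta)) => //; lra.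
Qed.

(** The vector [u + N u + ... + N^(n-1) u]. *)
Definition neumann_sum N u (n : nat) : T -> R :=
  iter n (fun v t => u t + N v t) (fun=> 0).

Lemma l2_neumann_sum N u n : l2_operator N -> l2 u -> l2 (neumann_sum N u n).
Proof.
move=> NL u2; elim: n => [|n ih]; first exact: l2_0.
by apply: l2D => //; exact: NL.1.
Qed.

Lemma neumann_sum_ge0 N u n : l2_operator N -> positive N -> l2 u ->
  (forall t, 0 <= u t) -> forall t, 0 <= neumann_sum N u n t.
Proof.
move=> NL N0 u2 u0; elim: n => [|n ih] t //=.
by rewrite addr_ge0//; apply: N0 => //; exact: l2_neumann_sum.
Qed.

(** Induction on [n], since [Q u = u + N (Q u)] and [N] is monotone. *)
Lemma neumann_sum_le_resolvent N Q u n : l2_operator N -> positive N ->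
  resolvent N Q 1 -> positive Q -> l2 u -> (forall t, 0 <= u t) ->
  forall t, neumann_sum N u n t <= Q u t.
Proof.
move=> NL N0 [QL _ QR] Q0 u2 u0; elim: n => [|n ih] t /=; first exact: Q0.
have := (QR _ u2).1 t; rewrite mul1r => /eqP; rewrite subr_eq => /eqP->.
rewrite lerD2l; apply: l2_operator_mono => //; last exact: QL.1.
exact: l2_neumann_sum.
Qed.

End ResolventPositivity.

(** * From complex to real matrices *)

Section ComplexToReal.
#[local] Existing Instance totally_filter.
Variables (R : realType) (T : choiceType).
Local Notation C := R[i].
Implicit Types (u : T -> R) (v w : T -> C).

Lemma norm_normc (z : C) : `|z| = (normc z)%:C%C.
Proof. by case: z => a b; rewrite normc_def. Qed.

Lemma normc_real (x : R) : normc x%:C%C = `|x|.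
Proof. by rewrite /normc /= expr0n addr0 sqrtr_sqr. Qed.

Lemma Re_le_normc (z : C) : `|complex.Re z| <= normc z.
Proof. by have := normc_ge_Re z; rewrite norm_normc lecR. Qed.

Lemma Im_le_normc (z : C) : `|complex.Im z| <= normc z.
Proof.
case: z => a b; rewrite /normc /= -sqrtr_sqr ler_wsqrtr// lerDr.
exact: sqr_ge0.
Qed.

Lemma ell2_real u : ell2 (fun t => (u t)%:C%C) <-> l2 u.
Proof.
have E : \esum_(t in [set: T]) (normc (u t)%:C%C ^+ 2)%:E = sqnorm u.
  by apply: eq_esum => t _; rewrite normc_real real_normK// num_real.
by rewrite /ell2 /mkset E.
Qed.

Lemma l2_Re v : ell2 v -> l2 (fun t => complex.Re (v t)).
Proof.
apply: le_lt_trans; apply: le_sqnorm => t.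
by rewrite (le_trans (Re_le_normc _))// ler_norm.
Qed.

Lemma l2_Im v : ell2 v -> l2 (fun t => complex.Im (v t)).
Proof.
apply: le_lt_trans; apply: le_sqnorm => t.
by rewrite (le_trans (Im_le_normc _))// ler_norm.
Qed.

Lemma partial_sum_real u (A : {fset T}) :
  partial_sum (fun s => (u s)%:C%C : C^o) A = (\sum_(i <- A) u i)%:C%C.
Proof. by rewrite /partial_sum big_seq_fsetE/= rmorph_sum. Qed.

(** For nonnegative terms the net of finite partial sums increases to the
    supremum; the hypothesis of convergence makes that supremum finite, and the
    limit real. *)
Lemma nonneg_sumE u : (forall t, 0 <= u t) ->
  cvg (partial_sum (fun s => (u s)%:C%C : C^o) @ totally) ->
  exists2 x : R, x%:E = \esum_(s in [set: T]) (u s)%:E &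
    summability.sum (fun s => (u s)%:C%C : C^o) = x%:C%C.
Proof.
move=> u0 cv.
set F := partial_sum _ in cv; set L := summability.sum _.
have FL : F @ totally --> (L : C^o) by [].
have near_L (e : R) : 0 < e -> exists A : {fset T}, forall B : {fset T},
    (A `<=` B)%fset -> normc (L - (\sum_(i <- B) u i)%:C%C) < e.
  move=> e0; have /cvgrPdist_lt := FL.
  move=> /(_ e%:C%C); rewrite ltcR => /(_ e0)[A _ AL].
  exists A => B AB; have := AL B AB.
  by rewrite /= /F partial_sum_real norm_normc ltcR.
have sum_mono (A B : {fset T}) : (A `<=` B)%fset ->
    \sum_(i <- A) u i <= \sum_(i <- B) u i.
  move=> AB; rewrite [leRHS](big_fsetID _ (mem A))/=.
  rewrite (_ : [fset x in B | x \in A]%fset = A); last first.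
    apply/fsetP => x; rewrite !inE /=; apply/andP/idP => [[]//|xA].
    by split=> //; exact: (fsubsetP AB).
  by rewrite lerDl sumr_ge0.
have sum_esum (A : {fset T}) :
    ((\sum_(i <- A) u i)%:E <= \esum_(s in [set: T]) (u s)%:E)%E.
  apply: esum_ge; exists [set` A]; first by split=> //; exact: finite_fset.
  by rewrite fsbig_finite//= set_fsetK sumEFin.
have sum_lt (A : {fset T}) x e : normc (L - (\sum_(i <- A) u i)%:C%C) < e ->
    x - complex.Re L <= x - \sum_(i <- A) u i + e.
  move=> h; have := Re_le_normc (L - (\sum_(i <- A) u i)%:C%C).
  move=> /le_lt_trans /(_ h); rewrite ltr_norml => /andP[].
  by case: (L) => a b /=; lra.
have upper : (\esum_(s in [set: T]) (u s)%:E <= (complex.Re L)%:E)%E.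
  apply: ge_ereal_sup => _ [X [finX _] <-].
  rewrite fsbig_finite//= sumEFin lee_fin.
  apply/ler_addgt0Pr => e e0; have [A AL] := near_L _ e0.
  have := sum_mono _ _ (fsubsetUr A (fset_set X)).
  by have := sum_lt _ 0 _ (AL _ (fsubsetUl A (fset_set X))); lra.
have upper_fin : \esum_(s in [set: T]) (u s)%:E \is a fin_num.
  rewrite ge0_fin_numE; first exact: le_lt_trans upper (ltry _).
  by apply: esum_ge0 => s _; rewrite lee_fin.
exists (complex.Re L).
  apply/eqP; rewrite eq_le upper andbT -(fineK upper_fin) lee_fin.
  apply/ler_addgt0Pr => e e0; have [A AL] := near_L _ e0.
  have := AL A (fsubset_refl _); have := sum_esum A.
  rewrite -(fineK upper_fin) lee_fin => h1 h2.
  have := Re_le_normc (L - (\sum_(i <- A) u i)%:C%C).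
  move=> /le_lt_trans /(_ h2); rewrite ltr_norml => /andP[_].
  by move: h1; case: (L) => a b /=; lra.
have ImL : complex.Im L = 0.
  apply/eqP; rewrite -normr_eq0 eq_le normr_ge0 andbT.
  apply/ler_addgt0Pr => e e0; have [A AL] := near_L _ e0; rewrite add0r.
  apply: le_trans (ltW (AL A (fsubset_refl _))).
  have := Im_le_normc (L - (\sum_(i <- A) u i)%:C%C).
  by case: (L) => a b /=; rewrite subr0.
by move: ImL; case: (L) => a b /= ->.
Qed.

Variable M : T -> T -> C.
Hypothesis Mdef : defined_on_ell2 M.

Lemma mx_operator_linear (a : C) v w t : ell2 v -> ell2 w ->
  mx_operator M (fun s => a * v s + w s) t =
  a * mx_operator M v t + mx_operator M w t.
Proof.
move=> v2 w2.
have [/(_ t) cv _] := Mdef v2; have [/(_ t) cw _] := Mdef w2.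
have cv' : partial_sum (fun s => v s * M s t : C^o) @ totally -->
  (mx_operator M v t : C^o) := cv.
have cw' : partial_sum (fun s => w s * M s t : C^o) @ totally -->
  (mx_operator M w t : C^o) := cw.
have cs : partial_sum (fun s => (a * v s + w s) * M s t : C^o) @ totally -->
    (a * mx_operator M v t + mx_operator M w t : C^o).
  rewrite (_ : partial_sum _ = (a \*: partial_sum (fun s => v s * M s t : C^o)) +
    partial_sum (fun s => w s * M s t : C^o)).
    exact: cvgD (cvgZl_tmp cv') cw'.
  apply/funext => A; rewrite /partial_sum !fctE /= scaler_sumr -big_split/=.
  by apply: eq_bigr => i _; rewrite mulrDl -mulrA.
exact: (@cvg_lim C^o (@norm_hausdorff _ _) _ _ _ _ _ cs).
Qed.

End ComplexToReal.

(** * The real operator of a nonnegative matrix *)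

Section RealPartOperator.
Variables (R : realType) (T : choiceType) (m : T -> T -> R).
Hypothesis m_ge0 : forall s t, 0 <= m s t.
Local Notation C := R[i].
Implicit Types (u : T -> R) (v w : T -> C).

Let M (s t : T) : C := (m s t)%:C%C.
Hypothesis Mdef : defined_on_ell2 M.

Definition complexify u : T -> C := fun t => (u t)%:C%C.

Definition re_operator u (t : T) : R := complex.Re (mx_operator M (complexify u) t).

Lemma ell2_complexify u : l2 u -> ell2 (complexify u).
Proof. by move=> u2; apply/ell2_real. Qed.

Lemma re_operator_nonneg u t : l2 u -> (forall s, 0 <= u s) ->
  mx_operator M (complexify u) t = (re_operator u t)%:C%C /\
  (re_operator u t)%:E = \esum_(s in [set: T]) (u s * m s t)%:E.
Proof.
move=> u2 u0; have [/(_ t) + _] := Mdef (ell2_complexify u2).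
rewrite /re_operator /mx_operator /mx_summable.
rewrite (_ : (fun s => _) = fun s => (u s * m s t)%:C%C); last first.
  by apply/funext => s; rewrite rmorphM.
by move=> /nonneg_sumE[s|x xE ->]; [exact: mulr_ge0|rewrite -xE].
Qed.

Lemma complexify_linear a (u v : T -> R) :
  complexify (fun t => a * u t + v t) =
  fun t => a%:C%C * complexify u t + complexify v t.
Proof. by apply/funext => t; rewrite /complexify rmorphD rmorphM. Qed.

(** Splitting [u] into its positive and negative parts reduces to nonnegative
    vectors, on which the coordinates are real. *)
Lemma mx_operator_complexify u t : l2 u ->
  mx_operator M (complexify u) t = (re_operator u t)%:C%C.
Proof.
move=> u2.
pose p t := Num.max 0 (u t); pose n t := Num.max 0 (- u t).
have p0 s : 0 <= p s by rewrite le_max lexx.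
have n0 s : 0 <= n s by rewrite le_max lexx.
have p2 : l2 p.
  by apply: le_l2 u2 => s; rewrite ger0_norm// ge_max normr_ge0 ler_norm.
have n2 : l2 n.
  apply: le_l2 u2 => s; rewrite ger0_norm// ge_max normr_ge0/=.
  by rewrite -normrN ler_norm.
rewrite /re_operator (_ : complexify u = complexify (fun t => -1 * n t + p t)).
  rewrite complexify_linear mx_operator_linear//; try exact: ell2_complexify.
  rewrite (re_operator_nonneg t p2 p0).1 (re_operator_nonneg t n2 n0).1.
  by rewrite -rmorphM -rmorphD.
congr complexify; apply/funext => s; rewrite /n /p.
by have [h|/ltW h] := leP 0 (u s); [rewrite max_l|rewrite max_r]; lra.
Qed.

Lemma re_operator_l2 : l2_operator re_operator.
Proof.
split=> [u u2|a u v u2 v2].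
  apply: (ell2_real _).1.
  rewrite (_ : (fun t => _) = mx_operator M (complexify u)).
    exact: (Mdef (ell2_complexify u2)).2.
  by apply/funext => t; rewrite mx_operator_complexify.
apply/funext => t; rewrite {1}/re_operator complexify_linear.
rewrite mx_operator_linear//; try exact: ell2_complexify.
by rewrite !mx_operator_complexify// -rmorphM -rmorphD.
Qed.

Lemma re_operator_positive : positive re_operator.
Proof.
move=> u u2 u0 t; rewrite -lee_fin (re_operator_nonneg t u2 u0).2.
by apply: esum_ge0 => s _; rewrite lee_fin mulr_ge0.
Qed.

Lemma Re_mx_operator w t : ell2 w ->
  complex.Re (mx_operator M w t) = re_operator (fun s => complex.Re (w s)) t.
Proof.
move=> w2; have rw2 := l2_Re w2; have iw2 := l2_Im w2.
rewrite {1}(_ : w = fun s => 'i%C * complexify (fun s => complex.Im (w s)) s +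
                          complexify (fun s => complex.Re (w s)) s); last first.
  by apply/funext => s; rewrite addrC [LHS]complexE.
rewrite mx_operator_linear//; try exact: ell2_complexify.
rewrite !mx_operator_complexify//=.
by rewrite mul0r mulr0 subr0 add0r.
Qed.

Lemma bounded_operator_sq_bounded (B : (T -> C) -> T -> C) K v :
  (forall v, ell2 v -> ell2_norm (B v) <= K * ell2_norm v) ->
  ell2 v -> ell2 (B v) ->
  (sqnorm (fun t => normc (B v t)) <=
   (K ^+ 2)%:E * sqnorm (fun t => normc (v t)))%E.
Proof.
move=> BK v2 Bv2; rewrite (sqnormE Bv2) (sqnormE v2) -EFinM lee_fin.
have := BK v v2; rewrite /ell2_norm.
rewrite -/(sqnorm (fun t => normc (v t))) -/(sqnorm (fun t => normc (B v t))).
have : 0 <= fine (sqnorm (fun t => normc (v t))) by rewrite fine_ge0// sqnorm_ge0.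
have : 0 <= fine (sqnorm (fun t => normc (B v t))) by rewrite fine_ge0// sqnorm_ge0.
set b := fine _; set a := fine _ => b0 a0 h.
rewrite -[b]sqr_sqrtr// -[a]sqr_sqrtr// -exprMn lerXn2r// nnegrE ?sqrtr_ge0//.
by apply: le_trans h; exact: sqrtr_ge0.
Qed.

(** The inverse [B] of [M - a] yields the resolvent [u |-> Re (B (- u))] over
    the reals, because [Re] commutes with the real matrix [M]. *)
Lemma invertible_resolvent (a : R) :
  invertible (fun v t => mx_operator M v t - a%:C%C * v t) ->
  exists Q, resolvent re_operator Q a.
Proof.
move=> [B [[B2 BL [K BK]] Binv]].
pose neg u : T -> C := complexify (fun t => - u t).
have neg2 u : l2 u -> ell2 (neg u).
  move=> u2; apply: ell2_complexify; apply: le_l2 u2 => t.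
  by rewrite normrN.
pose Q u t := complex.Re (B (neg u) t).
exists Q; split.
- split=> [u u2|b u v u2 v2]; first by apply: l2_Re; exact/B2/neg2.
  apply/funext => t; rewrite /Q.
  rewrite (_ : neg _ = fun t => b%:C%C * neg u t + neg v t); last first.
    apply/funext => s; rewrite /neg /complexify -rmorphM -rmorphD; congr _%:C%C.
    by ring.
  rewrite BL; [|exact: neg2|exact: neg2].
  by case: (B (neg u) t) => x y; case: (B (neg v) t) => x' y' /=; rewrite mul0r subr0.
- exists (K ^+ 2); split=> [|u u2]; first exact: sqr_ge0.
  apply: (@le_trans _ _ (sqnorm (fun t => normc (B (neg u) t)))).
    apply: le_sqnorm => t; apply: le_trans (Re_le_normc _) (ler_norm _).
  apply: le_trans (bounded_operator_sq_bounded BK (neg2 _ u2) (B2 _ (neg2 _ u2))) _.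
  apply: lee_wpmul2l; first by rewrite lee_fin sqr_ge0.
  by apply: le_sqnorm => t; rewrite normc_real normrN !normr_id.
move=> u u2; split=> [t|].
  have [_ /(congr1 (fun f => f t))] := Binv _ (neg2 _ u2).
  move=> /(congr1 (@complex.Re _)) /=.
  have w2 := B2 _ (neg2 _ u2).
  rewrite raddfB /= Re_mx_operator//.
  rewrite /Q; case: (B (neg u) t) => x y /=; rewrite mul0r subr0; lra.
have [+ _] := Binv _ (ell2_complexify u2).
move=> Bu; rewrite /Q; apply/funext => t.
rewrite (_ : neg _ = fun t => mx_operator M (complexify u) t - a%:C%C * complexify u t).
  by rewrite Bu.
apply/funext => s; rewrite mx_operator_complexify// /neg /complexify.
by rewrite -rmorphM -rmorphB opprB.
Qed.

End RealPartOperator.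

(** * Walks along measure-preserving maps *)

Section InvariantWalk.
Variables (R : realType) (T : choiceType) (X : finType) (tau : X -> T -> T).
Implicit Types (u g h : T -> R).

Definition walk_matrix (s t : T) : R :=
  #|[set x : X | tau x s == t]%SET|%:R / #|X|%:R.

Lemma walk_matrix_ge0 s t : 0 <= walk_matrix s t.
Proof. by rewrite divr_ge0. Qed.

Lemma walk_matrixE s t :
  walk_matrix s t = \sum_x #|X|%:R^-1 * (tau x s == t)%:R.
Proof.
rewrite -mulr_sumr mulrC /walk_matrix; congr (_ * _).
rewrite -sum1_card natr_sum big_mkcond/=; apply: eq_bigr => x _.
by rewrite inE; case: eqP.
Qed.

Definition pairing u h : \bar R := \esum_(t in [set: T]) (u t * h t)%:E.

Lemma le_pairing u v h : (forall t, u t <= v t) -> (forall t, 0 <= h t) ->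
  (pairing u h <= pairing v h)%E.
Proof.
by move=> uv h0; apply: le_esum => t _; rewrite lee_fin ler_wpM2r.
Qed.

Local Notation walk := (fun s t => (walk_matrix s t)%:C%C).
Hypothesis Mdef : defined_on_ell2 walk.
Let N := re_operator walk_matrix.

(** Duality: the operator pushes mass forward along the [tau x], so it pairs
    with [h] as [u] pairs with the average of the [h o tau x]. *)
Lemma pairing_walk u h : l2 u -> (forall t, 0 <= u t) -> (forall t, 0 <= h t) ->
  pairing (N u) h = (\sum_x #|X|%:R^-1%:E * pairing u (h \o tau x))%E.
Proof.
move=> u2 u0 h0; rewrite /pairing.
transitivity (\esum_(t in [set: T]) \esum_(s in [set: T])
    (h t * (u s * walk_matrix s t))%:E).
  apply: eq_esum => t _; rewrite mulrC EFinM.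
  rewrite (re_operator_nonneg walk_matrix_ge0 Mdef t u2 u0).2 -esumZ//.
  by move=> s; rewrite lee_fin mulr_ge0// walk_matrix_ge0.
rewrite esum_exchange; last first.
  by move=> t s; rewrite lee_fin !mulr_ge0// walk_matrix_ge0.
transitivity (\esum_(s in [set: T]) (\sum_x (#|X|%:R^-1 * (u s * h (tau x s)))%:E)%E).
  apply: eq_esum => s _.
  transitivity (\esum_(t in [set: T])
      (\sum_x (h t * (u s * (#|X|%:R^-1 * (tau x s == t)%:R)))%:E)%E).
    by apply: eq_esum => t _; rewrite walk_matrixE sumEFin !mulr_sumr.
  rewrite esum_sum; last by move=> t x _ _; rewrite lee_fin !mulr_ge0.
  apply: eq_bigr => x _; rewrite (@esumT1 _ _ _ (tau x s)).
  - by rewrite eqxx mulr1 mulrC [u s * _]mulrC -mulrA.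
  - by rewrite lee_fin !mulr_ge0.
  - by move=> t; rewrite eq_sym => /negPf->; rewrite !mulr0.
rewrite esum_sum; last by move=> s x _ _; rewrite lee_fin !mulr_ge0.
apply: eq_bigr => x _; rewrite -esumZ.
- by apply: eq_esum => s _; rewrite -EFinM.
- by rewrite invr_ge0.
- by move=> s; rewrite lee_fin mulr_ge0//= h0.
Qed.

Hypothesis X_gt0 : (0 < #|X|)%N.

(** Moving the operator to the other side of the pairing with [pairing_walk]
    turns the [k]-th term of the sum into the average of the pairings of [u]
    with [h o w] over the words [w] of length [k]. *)
Lemma pairing_neumann_sum (c : R) u h n : 0 <= c ->
  l2 u -> (forall t, 0 <= u t) -> (forall t, 0 <= h t) ->
  (forall w : seq X, (size w < n)%N ->
    (c%:E <= pairing u (fun t => h (foldr tau t w)))%E) ->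
  ((n%:R * c)%:E <= pairing (neumann_sum N u n) h)%E.
Proof.
move=> c0 u2 u0.
have NL : l2_operator N := re_operator_l2 walk_matrix_ge0 Mdef.
have N0 : positive N := re_operator_positive walk_matrix_ge0 Mdef.
elim: n h => [|n ih] h h0 hw.
  by rewrite mul0r; apply: esum_ge0 => t _; rewrite mul0r.
have s0 := neumann_sum_ge0 n NL N0 u2 u0.
have s2 := l2_neumann_sum n NL u2.
have -> : pairing (neumann_sum N u n.+1) h =
    (pairing u h + pairing (N (neumann_sum N u n)) h)%E.
  rewrite /pairing -esumD; last 2 first.
  - by move=> t _; rewrite lee_fin mulr_ge0.
  - by move=> t _; rewrite lee_fin mulr_ge0// N0.
  by apply: eq_esum => t _; rewrite -EFinD -mulrDl.
rewrite -natr1 mulrDl mul1r addrC EFinD; apply: leeD.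
  exact: (hw [::]).
rewrite pairing_walk//.
have -> : (n%:R * c)%:E = (\sum_(x in X) #|X|%:R^-1%:E * (n%:R * c)%:E)%E.
  rewrite sumEFin sumr_const -[X in _ = X%:E]mulr_natl mulrA divff ?mul1r//.
  by rewrite pnatr_eq0 -lt0n.
apply: lee_sum => x _; apply: lee_wpmul2l; first by rewrite lee_fin invr_ge0.
by apply: ih => [t|w wn]; [exact: h0|apply: (hw (x :: w))].
Qed.

End InvariantWalk.

Section SpectralRadius.
Variables (R : realType) (T : choiceType).

(** The product of the square roots of [a] and [b] is at least their minimum,
    which is [a - max 0 (a - b)]. *)
Lemma pairing_sqrt (f : T -> R) s : density f ->
  (\esum_(t in [set: T]) (Num.max 0 (f t - f (s t)))%:E <= 2^-1%:E * mass f)%E ->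
  (2^-1%:E * mass f <=
   pairing (Num.sqrt \o f) (fun t => Num.sqrt (f (s t))))%E.
Proof.
move=> df; have [f0 foo] := df.
have le_mass : (mass f <= pairing (Num.sqrt \o f) (fun t => Num.sqrt (f (s t))) +
    \esum_(t in [set: T]) (Num.max 0 (f t - f (s t)))%:E)%E.
  rewrite -esumD; last 2 first.
  - by move=> t _; rewrite lee_fin mulr_ge0 ?sqrtr_ge0.
  - by move=> t _; rewrite lee_fin le_max lexx.
  apply: le_esum => t _; rewrite -EFinD lee_fin /=.
  have [h|/ltW h] := leP (f t) (f (s t)).
    apply: (@le_trans _ _ (Num.sqrt (f t) * Num.sqrt (f t))).
      by rewrite -expr2 sqr_sqrtr.
    rewrite -[leLHS]addr0; apply: lerD; last by rewrite le_max lexx.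
    by apply: ler_wpM2l; [exact: sqrtr_ge0|exact: ler_wsqrtr].
  rewrite max_r ?subr_ge0// -lerBlDr opprB addrCA subrr addr0.
  apply: (@le_trans _ _ (Num.sqrt (f (s t)) * Num.sqrt (f (s t)))).
    by rewrite -expr2 sqr_sqrtr.
  by apply: ler_wpM2r; [exact: sqrtr_ge0|exact: ler_wsqrtr].
move=> ex; have := le_trans le_mass (leeD2l _ ex).
have : (0 <= pairing (Num.sqrt \o f) (fun t => Num.sqrt (f (s t))))%E.
  by apply: esum_ge0 => t _; rewrite lee_fin mulr_ge0 ?sqrtr_ge0.
rewrite (massE df); case: (pairing _ _) => [p _| _ _|//]; last by rewrite leey.
by rewrite -EFinM -EFinD !lee_fin; lra.
Qed.

Lemma pairing_le_sqnorm (u v : T -> R) :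
  (pairing u v <= 2^-1%:E * (sqnorm u + sqnorm v))%E.
Proof.
rewrite -esumD; try by move=> t _; rewrite lee_fin sqr_ge0.
rewrite -esumZ//; last by move=> t; rewrite -EFinD lee_fin addr_ge0 ?sqr_ge0.
apply: le_esum => t _; rewrite -EFinD -EFinM lee_fin.
by have := sqr_ge0 (u t - v t); rewrite sqrrB; lra.
Qed.

Lemma invertible_of_spectral_radius (A : (T -> R[i]) -> T -> R[i]) (a : R) :
  (spectral_radius A < 1%:E)%E -> 1 <= a ->
  invertible (fun v t => A v t - a%:C%C * v t).
Proof.
move=> rho a1; apply: contrapT => ninv; move: rho; rewrite ltNge => /negP; apply.
apply: (@le_trans _ _ (normc a%:C%C)%:E).
  by rewrite lee_fin normc_real; apply: le_trans a1 (ler_norm _).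
by apply: ereal_sup_ubound; exists a%:C%C.
Qed.

(** With [K] a bound for the square norm of [(1 - M)^-1], any [n > K + 1] leads
    to a contradiction: the pairing of the Neumann sum of [g] with [g] is at
    least [n / 2] times the mass of [f], and at most [(K + 1) / 2] times it. *)
Theorem invariant_walk_spectral_radius (X : finType) (tau : X -> T -> T)
    (mu : set T -> R) (M : T -> T -> R[i]) :
  finitely_additive_probability mu ->
  (forall x Y, mu [set t | Y (tau x t)] = mu Y) -> (0 < #|X|)%N ->
  (forall s t, M s t = (walk_matrix R tau s t)%:C%C) ->
  ~ defined_on_ell2 M \/ (1%:E <= spectral_radius (mx_operator M))%E.
Proof.
move=> mu_fap mu_inv X_gt0 ME.
have {ME}-> : M = fun s t => (walk_matrix R tau s t)%:C%C.
  by apply/funext => s; apply/funext => t.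
have [Mdef|] := pselect (defined_on_ell2 (fun s t => (walk_matrix R tau s t)%:C%C));
  last by left.
right; rewrite leNgt; apply/negP => rho.
have m0 := walk_matrix_ge0 R tau.
pose N := re_operator (walk_matrix R tau).
have NL : l2_operator N := re_operator_l2 m0 Mdef.
have N0 : positive N := re_operator_positive m0 Mdef.
have res (a : R) : 1 <= a -> exists Q, resolvent N Q a.
  by move=> a1; apply: (invertible_resolvent m0 Mdef); apply: invertible_of_spectral_radius.
have [Q Qres] := res 1 (lexx _).
have Q0 := resolvent_positive_at1 NL N0 res Qres.
have [QL [K [K0 QK]] _] := Qres.
pose n := (Num.truncn (K + 1)).+1.
have nK : K + 1 < n%:R by exact: truncnS_gt.
(* the letters of [w] act from the last one to the first *)
pose sigma (w : n.-bseq X) t := foldr tau t w.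
have sigma_inv w Y : mu [set t | Y (sigma w t)] = mu Y.
  rewrite /sigma; elim: (bseqval w) Y => [|x r ih] Y //=.
  by rewrite (ih [set t | Y (tau x t)]) mu_inv.
have half0 : 0 < 2^-1 :> R by rewrite invr_gt0.
have [f [df mf0 fex]] := exists_almost_invariant_density mu_fap sigma_inv half0.
have [f0 _] := df.
pose g := Num.sqrt \o f.
have g0 t : 0 <= g t by exact: sqrtr_ge0.
have gm : sqnorm g = mass f.
  by apply: eq_esum => t _; rewrite sqr_sqrtr.
have g2 : l2 g by rewrite /l2 gm; case: df.
pose c := 2^-1 * fine (mass f).
have cE : c%:E = (2^-1%:E * mass f)%E by rewrite EFinM -massE.
have mf : 0 < fine (mass f) by rewrite -lte_fin -massE.
have c0 : 0 <= c by rewrite /c; lra.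
have := pairing_neumann_sum Mdef X_gt0 (c := c) (h := g) (n := n) c0 g2 g0 g0.
have hw (w : seq X) : (size w < n)%N ->
    (c%:E <= pairing g (fun t => g (foldr tau t w)))%E.
  move=> /ltnW wn; rewrite cE; apply: (@pairing_sqrt f (sigma (Bseq wn)) df).
  exact: fex.
move=> /(_ hw) lower.
have := le_trans lower (le_pairing (neumann_sum_le_resolvent n NL N0 Qres Q0 g2 g0) g0).
move=> /le_trans /(_ (pairing_le_sqnorm _ _)).
have := QK g g2; have Qg2 := QL.1 _ g2.
rewrite (sqnormE Qg2) gm massE// -EFinD -!EFinM !lee_fin /c.
set p := fine (mass f) in mf *; set q := fine _ => h1 h2.
have : (K + 1) * p < n%:R * p by rewrite ltr_pM2r.
lra.
Qed.

End SpectralRadius.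

Section Amenable.
Variables (R : realType) (S : semigroupType) (X : finType).
Variable phi : {multiplicative free_semigroup X -> S}.
Hypothesis phi_surj : forall s : S, exists w : free_semigroup X, phi w = s.

Lemma inS1M (a b : S) : inS1 (a * b)%g = (inS1 a * inS1 b)%g.
Proof.
suff h i : adjoin_in i (a * b)%g = adjoin_mul (adjoin_in i a) (adjoin_in i b).
  exact: h.
by case: i => //=.
Qed.

(** Without letters there are no words, hence [S] is empty, and no finitely
    additive measure gives the empty set the mass 1. *)
Lemma generators_gt0 (mu : set S -> R) : finitely_additive_probability mu ->
  (0 < #|X|)%N.
Proof.
move=> mu_fap; rewrite lt0n; apply/eqP => X0.
have /eqP : mu setT = mu set0.
  congr mu; apply/seteqP; split=> // s _.
  have [[[|x w] wn0] _] := phi_surj s; first by [].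
  by have := fintype0 x X0.
by have [_ -> _] := mu_fap; rewrite fap0// oner_eq0.
Qed.

Lemma fap_inS1 (mu : set S -> R) : finitely_additive_probability mu ->
  finitely_additive_probability (fun Y : set (S1 S) => mu [set s | Y (inS1 s)]).
Proof.
move=> [mu0 mu1 muD]; split=> [A||A B AB]; first exact: mu0.
  by rewrite -mu1.
rewrite -muD//; apply/seteqP; split=> s //= [As Bs].
by have : (A `&` B) (inS1 s) by []; rewrite AB.
Qed.

End Amenable.

Theorem theorem6p1 (R : realType) (S : semigroupType) (X : finType)
    (phi : {multiplicative free_semigroup X -> S})
    (phi_surj : forall s : S, exists w : free_semigroup X, phi w = s) :
  (left_amenable R S ->
     ~ defined_on_ell2 (left_walk R phi) \/
     (1%:E <= spectral_radius (mx_operator (left_walk R phi)))%E) /\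
  (right_amenable R S ->
     ~ defined_on_ell2 (right_walk R phi) \/
     (1%:E <= spectral_radius (mx_operator (right_walk R phi)))%E).
Proof.
split=> -[mu [mu_fap mu_inv]].
  apply: (invariant_walk_spectral_radius (tau := fun x s => (gen phi x * s)%g)
    (fap_inS1 mu_fap) _ (generators_gt0 phi_surj mu_fap)) => [x Y|s t].
    rewrite -(mu_inv [set s | Y (inS1 s)] (phi (letter x))).
    by congr mu; apply/seteqP; split=> s /=; rewrite inS1M.
  by rewrite /left_walk /walk_matrix rmorphM fmorphV !rmorph_nat.
apply: (invariant_walk_spectral_radius (tau := fun x s => (s * gen phi x)%g)
  (fap_inS1 mu_fap) _ (generators_gt0 phi_surj mu_fap)) => [x Y|s t].
  rewrite -(mu_inv [set s | Y (inS1 s)] (phi (letter x))).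
  by congr mu; apply/seteqP; split=> s /=; rewrite inS1M.
by rewrite /right_walk /walk_matrix rmorphM fmorphV !rmorph_nat.
Qed.
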